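(* Let $N_{\mathsf s}\ge1$ be a fixed integer, $\beta\in(0,\infty)$, $\gamma>0$, and for each integer $N_{\mathsf h}\ge1$ set $N=N_{\mathsf s}N_{\mathsf h}$ and let $K=K_N$ with $K_N/N\to\beta$. Let $\boldsymbol{S}=[\boldsymbol{s}_1,\dots,\boldsymbol{s}_K]\in\mathbb{R}^{N\times K}$ have independent columns, each an $(N_{\mathsf s},N_{\mathsf h})$-sequence. Consider $\boldsymbol{y}=\boldsymbol{S}\boldsymbol{b}+\boldsymbol{n}$ with $\boldsymbol{b}=(\mathsf b_1,\dots,\mathsf b_K)$ having i.i.d. $\mathcal{CN}(0,\mathcal E)$ entries, $\boldsymbol{n}\sim\mathcal{CN}(\boldsymbol 0,\mathcal N_0\boldsymbol I_N)$, $\boldsymbol b,\boldsymbol n,\boldsymbol S$ independent, and $\gamma=\mathcal E/\mathcal N_0$. Let $\mathsf y_1=\boldsymbol{s}_1^{\mathsf T}\boldsymbol{y}$ be the output of the single-user matched filter of user 1. Then, as $N\to\infty$, \[ \beta\, I(\mathsf y_1;\mathsf b_1\mid \boldsymbol S)\ \to\ I^{\mathsf{sumf}}_{\mathrm{TH}}(\beta,\gamma,N_{\mathsf s}):=\beta\sum_{k\ge0}\frac{(N_{\mathsf s}^2\beta)^k}{k!}e^{-N_{\mathsf s}^2\beta}\log_2\!\Big(1+\frac{\gamma}{1+\frac{k}{N_{\mathsf s}^2}\gamma}\Big), \] where mutual information is measured in bits.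
   Context: An $(N_{\mathsf s},N_{\mathsf h})$-sequence is a random vector $\boldsymbol{s}\in\mathbb{R}^N$, $N=N_{\mathsf s}N_{\mathsf h}$, such that for each $m=1,\dots,N_{\mathsf s}$ the block $(s_{1+(m-1)N_{\mathsf h}},\dots,s_{mN_{\mathsf h}})$ has exactly one nonzero entry, whose position within the block is uniform and whose value is $\pm1/\sqrt{N_{\mathsf s}}$ with equal probability, all choices independent. $\mathcal{CN}(\mu,\sigma^2)$ denotes the circularly symmetric complex Gaussian distribution. The quantity $\beta I(\mathsf y_1;\mathsf b_1\mid\boldsymbol S)$ is the sum mutual information per chip (b/s/Hz) for a bank of single-user matched filters followed by independent decoders each knowing $\boldsymbol S$. *)

(* Defs.v *)
From HB Require Import structures.
From mathcomp Require Import all_boot all_order all_algebra.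
From mathcomp Require Import all_classical all_reals all_analysis.
Set Implicit Arguments. Unset Strict Implicit. Unset Printing Implicit Defensive.
Import Order.TTheory GRing.Theory Num.Theory.
Import numFieldNormedType.Exports.
Local Open Scope classical_set_scope.
Local Open Scope ring_scope.

Section Defs.
Context {R : realType}.

Definition log2 (x : R) : R := ln x / ln 2.

(* A vector v in R^(Ns*Nh) (0-based index i lies in block i %/ Nh) is a
   possible realisation of an (Ns,Nh)-sequence: every block has exactly one
   nonzero entry, and each nonzero entry is +-1/sqrt Ns. *)
Definition valid_seq (Ns Nh : nat) (v : 'I_(Ns * Nh) -> R) : Prop :=
  (forall m : 'I_Ns,
      #|[set i : 'I_(Ns * Nh) | ((i %/ Nh)%N == m) && (v i != 0)]| = 1%N) /\
  (forall i, v i != 0 ->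
      v i = (Num.sqrt (Ns%:R))^-1 \/ v i = - (Num.sqrt (Ns%:R))^-1).

(* Law of an (Ns,Nh)-sequence: in each of the Ns blocks the position
   (Nh choices) and the sign (2 choices) are uniform and independent, so each
   admissible realisation has probability (2 Nh)^(-Ns). *)
Definition seq_prob (Ns Nh : nat) (v : 'I_(Ns * Nh) -> R) : R :=
  if `[< valid_seq v >] then ((2 * Nh)%:R ^- Ns) else 0.

Definition spread_prob (Ns Nh K : nat) (M : 'M[R]_(Ns * Nh, K)) : R :=
  \prod_(k < K) seq_prob (fun i => M i k).

(* ---------- mutual information (Dobrushin / Gelfand-Yaglom definition) ---- *)
Definition is_mpartition {d} {X : measurableType d} (n : nat)
    (A : 'I_n -> set X) : Prop :=
  (forall i, measurable (A i)) /\
  (forall i j, i != j -> A i `&` A j = set0) /\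
  (forall x, exists i, A i x).

Definition kl_term (p a b : R) : R :=
  if p == 0 then 0 else p * log2 (p / (a * b)).

Definition mutual_info {d dX dY} {T : measurableType d}
    {X : measurableType dX} {Y : measurableType dY}
    (mu : set T -> \bar R) (f : T -> X) (g : T -> Y) : \bar R :=
  ereal_sup [set v | exists (n m : nat) (A : 'I_n -> set X) (B : 'I_m -> set Y),
     is_mpartition A /\ is_mpartition B /\
     v = (\sum_(i < n) \sum_(j < m)
            kl_term (fine (mu (f @^-1` A i `&` g @^-1` B j)))
                    (fine (mu (f @^-1` A i)))
                    (fine (mu (g @^-1` B j))))%:E].

Definition cond_prob {d} {T : measurableType d} (P : set T -> \bar R)
    (E : set T) : set T -> \bar R :=
  fun A => (fine (P (A `&` E)) / fine (P E))%:E.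

Definition cond_mutual_info {d dX dY} {T : measurableType d}
    {X : measurableType dX} {Y : measurableType dY} {U : choiceType}
    (P : set T -> \bar R) (f : T -> X) (g : T -> Y) (Z : T -> U) : \bar R :=
  \esum_(z in [set z | (0 < P [set w | Z w = z])%E])
     (P [set w | Z w = z] * mutual_info (cond_prob P [set w | Z w = z]) f g)%E.

Definition ITH_sumf (beta gamma : R) (Ns : nat) : R :=
  let c := (Ns ^ 2)%:R * beta in
  beta * limn (fun n => \sum_(k < n) (c ^+ k / (k`!)%:R * expR (- c)
           * log2 (1 + gamma / (1 + k%:R / (Ns ^ 2)%:R * gamma)))).

(* matched-filter output of user 1 (index 0): s_1^T (S b + n), with complex
   numbers represented as (real part, imaginary part) *)
Definition mf_output (N K : nat) (S : 'M[R]_(N, K.+1))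
    (b : 'I_K.+1 -> R * R) (z : 'I_N -> R * R) : R * R :=
  (\sum_(i < N) S i ord0 * (\sum_(k < K.+1) S i k * (b k).1 + (z i).1),
   \sum_(i < N) S i ord0 * (\sum_(k < K.+1) S i k * (b k).2 + (z i).2)).

End Defs.

(* Main.v *)
(* Given S, the output splits into two independent real Gaussian channels
   y = b + w, because linear combinations of independent centred normals are
   normal; the variance of w is v = N0/2 + (E/2) sum_(k >= 2) rho_k^2, where rho_k
   is the correlation of the sequences of users 1 and k.  The mutual information
   of such a channel is the mean of the log-likelihood ratio: on every finite
   rectangular partition Jensen's inequality bounds the relative entropy by it,
   and the bound is approached by quantising the ratio on finer and finer grids.
   Hence I(y_1; b_1 | S) is the expectation of the bounded function
   log2 (1 + g / (1 + g sum_k rho_k^2)), g = E/N0.  Given the sequence of user 1,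
   the rho_k^2 are i.i.d.; they vanish when no block collides and equal 1/Ns^2
   when exactly one does.  The other cases have probability O(1/Nh^2) per user,
   so they are negligible, and the number of collisions is asymptotically Poisson
   with mean Ns^2 beta. *)

Require Import Defs.
From HB Require Import structures.
From mathcomp Require Import all_boot all_order all_algebra.
From mathcomp Require Import all_classical all_reals all_analysis.
From mathcomp Require Import measurable_realfun ring lra.
Import Order.TTheory GRing.Theory Num.Theory.
Import numFieldNormedType.Exports.
Local Open Scope classical_set_scope.
Local Open Scope ring_scope.
Set Implicit Arguments.
Unset Strict Implicit.
Unset Printing Implicit Defensive.

(** * Scaled Gaussian laws *)

(** [mutual_info] sees only probabilities of rectangles, and [cond_prob] is a bare set function. The
    likelihood ratio is therefore not produced as a Radon-Nikodym derivative: a function [phi] is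
    given, and the integral of [exp (- phi)] over each rectangle is checked to be the product of the
    marginal probabilities. The lower bound uses the dual form of relative entropy, which accepts
    any function constant on cells; the quantised ratio is set to 0 outside a growing box, and that
    value supplies the dominating function. Correlations can vanish, so Gaussian laws of variance 0
    must take part in the sums. Collisions in several blocks are not estimated separately.
    Interferers are replaced one at a time, at a total cost of [B (1 - (p0 + p1)^K)], with p0 and p1
    the probabilities of no collision and of exactly one. With r = p1 / p0, the power p0^K tends to
    exp (- lambda) and (1 + r)^K to exp lambda, so the mass (p0 + p1)^K tends to 1. This one limit
    removes the error and also excludes an escape of mass in the Poisson limit. *)

Definition pushm d d' (T1 : measurableType d) (T2 : measurableType d') (R : realType)
  (m : {measure set T1 -> \bar R}) (f : T1 -> T2) (mf : measurable_fun setT f) :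
    {measure set T2 -> \bar R} :=
  measure_function_pushforward__canonical__measure_function_Measure m mf.

Section gaussian.
Context {R : realType}.
Local Notation mu := (@lebesgue_measure R).

Lemma measurable_affine (c d : R) :
  measurable_fun setT (fun x : measurableTypeR R => c * x + d : measurableTypeR R).
Proof. by apply: measurable_funD => //; exact: measurable_funM. Qed.

(** By uniqueness of Lebesgue measure it suffices to compare the two measures on intervals []a,
    b]]. *)
Lemma lebesgue_measure_affine (c d : R) (A : set R) : c != 0 -> measurable A ->
  mu A = (`|c|%:E * mu ((fun x => (c * x + d)%R) @^-1` A))%E.
Proof.
move=> c0 mA.
pose m' : {measure set (measurableTypeR R) -> \bar R} :=
  mscale (NngNum (normr_ge0 c)) (pushm mu (measurable_affine c d)).
rewrite (@lebesgue_measure_unique _ m') // => X [[a b] _ <-] /=.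
rewrite /m' /mscale/= /pushm/= /pushforward.
have [c_gt0|c_lt0|c_eq0] := ltgtP 0 c; last by rewrite c_eq0 eqxx in c0.
- have -> : (fun x : R => c * x + d) @^-1` `]a, b] = `] ((a - d) / c), ((b - d) / c)]%classic.
    apply/seteqP; split=> x /=; rewrite !in_itv/= ltr_pdivrMr// ler_pdivlMr// ltrBlDr lerBrDr mulrC//.
  rewrite !lebesgue_measure_itv/= !lte_fin ltr_pM2r ?invr_gt0// ltrD2r.
  case: ifP => // ab; last by rewrite mule0.
  rewrite -!EFinB -EFinM gtr0_norm//; congr (_%:E); field.
  exact: c0.
(* For [c < 0] the map reverses order: the preimage is closed on the left and open on the right,
   with the same length. *)
- have -> : (fun x : R => c * x + d) @^-1` `]a, b] = `[((b - d) / c), ((a - d) / c)[%classic.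
    apply/seteqP; split=> x /=; rewrite !in_itv/= ltr_ndivlMr// ler_ndivrMr// ltrBlDr lerBrDr mulrC andbC//.
  rewrite !lebesgue_measure_itv/= !lte_fin ltr_nM2r ?invr_lt0// ltrD2r.
  case: ifP => // ab; last by rewrite mule0.
  rewrite -!EFinB -EFinM ltr0_norm//; congr (_%:E); field.
  exact: c0.
Qed.

Lemma integral_affine (c d : R) (h : R -> \bar R) : c != 0 -> measurable_fun setT h ->
  (forall x, 0 <= h x)%E ->
  (\int[mu]_x h x = `|c|%:E * \int[mu]_x h (c * x + d)%R)%E.
Proof.
move=> c0 mh h0.
pose m' : {measure set (measurableTypeR R) -> \bar R} :=
  mscale (NngNum (normr_ge0 c)) (pushm mu (measurable_affine c d)).
transitivity (\int[m']_x h x)%E.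
  apply: eq_measure_integral => A mA _; rewrite /m'/=/mscale/= /pushforward/=.
  exact: lebesgue_measure_affine.
rewrite /m' ge0_integral_mscale//=.
by rewrite ge0_integral_pushforward//= ?preimage_setT//; exact: measurable_affine.
Qed.

(** The Radon-Nikodym derivative is known only abstractly; it agrees almost everywhere with
    [normal_pdf] because both have the same integral over every measurable subset of [D]. *)
Lemma ge0_integral_normal_prob (m s : R) (D : set R) (h : R -> \bar R) :
  measurable D -> measurable_fun D h -> (forall x, 0 <= h x)%E ->
  (\int[normal_prob m s]_(x in D) h x = \int[mu]_(x in D) (h x * (normal_pdf m s x)%:E))%E.
Proof.
move=> mD mh h0.
rewrite -(Radon_Nikodym_SigmaFinite.change_of_variables (normal_prob_dominates m s))//.
apply: ae_eq_integral => //.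
- apply: emeasurable_funM => //; apply: measurable_funTS.
  apply: (measurable_int mu). 
  exact: (Radon_Nikodym_SigmaFinite.f_integrable (normal_prob_dominates m s)).
- apply: emeasurable_funM => //; apply/measurable_EFinP; apply: measurable_funTS; exact: measurable_normal_pdf.
- apply: ae_eqe_mul2l.
  apply: integral_ae_eq => //.
  - apply: (integrableS measurableT) => //.
    exact: (Radon_Nikodym_SigmaFinite.f_integrable (normal_prob_dominates m s)).
  - apply/measurable_EFinP; apply: measurable_funTS; exact: measurable_normal_pdf.
  - move=> A AD mA; rewrite -Radon_Nikodym_SigmaFinite.f_integral//.
    exact: normal_prob_dominates.
Qed.


Let scale1 (s : R) : measurableTypeR R -> R := fun x => s * x.
Let measurable_scale1 s : measurable_fun setT (scale1 s).
Proof. exact: measurable_funM. Qed.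

(* defined as a pushforward so that s = 0 gives the Dirac mass, whereas
   [normal_prob 0 0] is uniform on [0, 1] *)
Definition gauss (s : R) : set R -> \bar R :=
  pushforward (normal_prob 0 1) (scale1 s).

HB.instance Definition _ s := Measure.copy (gauss s)
  (pushm (normal_prob 0 1) (measurable_scale1 s)).

Let gauss_setT s : gauss s setT = 1%E.
Proof. by rewrite /gauss /pushforward preimage_setT; exact: probability_setT. Qed.

HB.instance Definition _ s := Measure_isProbability.Build _ _ R (gauss s) (gauss_setT s).

Lemma ge0_integral_gauss1 s (h : R -> \bar R) : measurable_fun setT h ->
  (forall x, 0 <= h x)%E ->
  (\int[gauss s]_x h x = \int[normal_prob 0 1]_x h (s * x)%R)%E.
Proof.
move=> mh h0; rewrite ge0_integral_pushforward ?preimage_setT//.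
Qed.

Lemma normal_pdf_scale s x : s != 0 ->
  `|s| * normal_pdf 0 s (s * x) = normal_pdf 0 1 x :> R.
Proof.
move=> s0; rewrite !normal_pdfE ?oner_neq0// /normal_peak /normal_fun !subr0.
rewrite mulrA; congr (_ * expR _).
  rewrite expr1n mul1r -mulrnAr sqrtrM ?sqr_ge0// sqrtr_sqr invfM mulrA divff ?mul1r// normr_eq0//.
rewrite expr1n exprMn -mulrN -mulrnAr -mulr_natr -[in RHS]mulr_natr; field.
by rewrite s0.
Qed.

Lemma ge0_integral_gauss s (h : R -> \bar R) : s != 0 -> measurable_fun setT h ->
  (forall x, 0 <= h x)%E ->
  (\int[gauss s]_x h x = \int[mu]_x (h x * (normal_pdf 0 s x)%:E))%E.
Proof.
move=> s0 mh h0; rewrite (ge0_integral_gauss1 s mh h0).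
have mhs : measurable_fun setT (h \o scale1 s).
  exact: (measurableT_comp mh (measurable_scale1 s)).
rewrite (@ge0_integral_normal_prob 0 1 setT (h \o scale1 s) measurableT mhs (fun x => h0 _)).
have mpdf : measurable_fun [set: R] (fun x => (normal_pdf 0 s x)%:E).
  by apply/measurable_EFinP; exact: measurable_normal_pdf.
have mhpdf : measurable_fun setT (fun x => h x * (normal_pdf 0 s x)%:E)%E.
  exact: emeasurable_funM.
have hpdf0 x : (0 <= h x * (normal_pdf 0 s x)%:E)%E.
  by rewrite mule_ge0// lee_fin normal_pdf_ge0.
rewrite [RHS](integral_affine 0 s0 mhpdf hpdf0).
rewrite -ge0_integralZl//=.
- apply: eq_integral => x _; rewrite addr0 muleCA -EFinM normal_pdf_scale//.
- exact: (measurableT_comp mhpdf (measurable_affine s 0)).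
Qed.


Lemma gaussE s (A : set R) : s != 0 -> measurable A -> gauss s A = normal_prob 0 s A.
Proof.
move=> s0 mA; transitivity (\int[gauss s]_x (\1_A x)%:E)%E.
  by rewrite integral_indic// setIT.
rewrite ge0_integral_gauss//.
- rewrite -ge0_integral_normal_prob//.
    rewrite integral_indic ?setIT//.
  by apply/measurable_EFinP; exact: measurable_indic.
- by apply/measurable_EFinP; exact: measurable_indic.
Qed.

Lemma integral_gauss0 (h : R -> \bar R) : measurable_fun setT h ->
  (forall x, 0 <= h x)%E -> (\int[gauss 0]_x h x = h 0%R)%E.
Proof.
move=> mh h0; rewrite ge0_integral_gauss1//.
under eq_integral do rewrite mul0r.
rewrite integral_cst// [X in (_ * X)%E](_ : _ = 1%E) ?mule1//.
exact: probability_setT.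
Qed.

Lemma normal_pdf_abs (s x : R) : normal_pdf 0 `|s| x = normal_pdf 0 s x.
Proof.
by rewrite /normal_pdf normr_eq0 /normal_peak /normal_fun real_normK// num_real.
Qed.

(** [Num.sqrt (s ^+ 2)] is the absolute value of [s], whereas [s] may carry the sign of a
    correlation. *)
Lemma integral_gauss_abs s (h : R -> \bar R) : measurable_fun setT h ->
  (forall x, 0 <= h x)%E ->
  (\int[gauss `|s|]_x h x = \int[gauss s]_x h x)%E.
Proof.
move=> mh h0; have [->|s0] := eqVneq s 0; first by rewrite normr0.
have s'0 : `|s| != 0 by rewrite normr_eq0.
rewrite (ge0_integral_gauss s0 mh h0) (ge0_integral_gauss s'0 mh h0).
by apply: eq_integral => x _; rewrite normal_pdf_abs.
Qed.

(** Completing the square: the joint density of [x] and the sum [y] factors into the density of [y]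
    and the conditional density of [x] given [y]. *)
Lemma normal_pdf_conv (a b x y : R) : a != 0 -> b != 0 ->
  let c := Num.sqrt (a ^+ 2 + b ^+ 2) in
  normal_pdf 0 b (y - x) * normal_pdf 0 a x =
  normal_pdf 0 c y * normal_pdf (a ^+ 2 / c ^+ 2 * y) (a * b / c) x.
Proof.
move=> a0 b0 c.
have ab0 : 0 < a ^+ 2 + b ^+ 2 by rewrite ltr_pwDl ?sqr_ge0// exprn_even_gt0.
have c0 : c != 0 by rewrite gt_eqF// sqrtr_gt0.
have c2 : c ^+ 2 = a ^+ 2 + b ^+ 2 by rewrite sqr_sqrtr// ltW.
have s0 : a * b / c != 0 by rewrite !mulf_neq0// invr_eq0.
rewrite !normal_pdfE// mulrACA [RHS]mulrACA; congr (_ * _).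
  rewrite /normal_peak -!invfM -!sqrtrM; [|by rewrite mulrn_wge0// mulr_ge0// ?pi_ge0// sqr_ge0..].
  congr (Num.sqrt _)^-1; rewrite !mulr2n !expr_div_n !exprMn.
  by move: (pi : R) c0; clearbody c => p c0; field.
rewrite /normal_fun !subr0 -!expRD; congr expR.
rewrite !expr_div_n !exprMn !c2 !mulr2n; field.
by rewrite -!mulr2n !mulrn_eq0/= !expf_neq0 ?mulf_neq0// gt_eqF.
Qed.

Lemma gauss_conv (a b : R) (h : R -> \bar R) : measurable_fun setT h ->
  (forall x, 0 <= h x)%E ->
  (\int[gauss a]_x \int[gauss b]_y h (x + y)%R =
   \int[gauss (Num.sqrt (a ^+ 2 + b ^+ 2))]_x h x)%E.
Proof.
move=> mh h0.
have madd x : measurable_fun setT (fun y : R => x + y) by exact: measurable_funD.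
have mhadd x : measurable_fun setT (fun y : R => h (x + y)).
  exact: (measurableT_comp mh (madd x)).
have mF : measurable_fun setT (fun z : R * R => h (z.1 + z.2)).
  apply: (measurableT_comp mh).
  exact: (measurable_funD measurable_fst measurable_snd).
have mI : measurable_fun setT (fun x : R => \int[gauss b]_y h (x + y)%R)%E.
  exact: (@measurable_fun_fubini_tonelli_F _ _ _ _ _ (gauss b) (fun z : R * R => h (z.1 + z.2))).
have I0 x : (0 <= \int[gauss b]_y h (x + y)%R)%E by exact: integral_ge0.
(* The degenerate laws have no density and are treated apart. *)
have [->|a0] := eqVneq a 0.
  rewrite (integral_gauss0 mI I0) expr0n/= add0r sqrtr_sqr (integral_gauss_abs b mh h0).
  by under eq_integral do rewrite add0r.
have [->|b0] := eqVneq b 0.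
  rewrite expr0n/= addr0 sqrtr_sqr (integral_gauss_abs a mh h0).
  apply: eq_integral => x _.
  by rewrite (integral_gauss0 (mhadd x) (fun y => h0 _)) addr0.
set c := Num.sqrt _.
have c0 : c != 0.
  by rewrite gt_eqF// sqrtr_gt0 ltr_pwDl ?sqr_ge0// exprn_even_gt0.
have mpdf m s : measurable_fun [set: R] (fun x => (normal_pdf m s x)%:E).
  by apply/measurable_EFinP; exact: measurable_normal_pdf.
pose F (z : measurableTypeR R * measurableTypeR R) : \bar R :=
  (h z.2 * (normal_pdf 0 b (z.2 - z.1) * normal_pdf 0 a z.1)%:E)%E.
have mF2 : measurable_fun setT F.
  apply: emeasurable_funM; first exact: (measurableT_comp mh measurable_snd).
  apply/measurable_EFinP; apply: measurable_funM.
    apply: (measurableT_comp (@measurable_normal_pdf R 0 b)).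
    exact: (measurable_funB measurable_snd measurable_fst).
  exact: (measurableT_comp (@measurable_normal_pdf R 0 a) measurable_fst).
have F0 z : (0 <= F z)%E.
  by rewrite mule_ge0// lee_fin mulr_ge0// normal_pdf_ge0.
(* The second variable of [F] is the sum, reached by translating by [x]. After exchanging the
   integrals, the conditional density of [x] integrates to 1. *)
transitivity (\int[mu]_x \int[mu]_y F (x, y))%E.
  rewrite (ge0_integral_gauss a0 mI I0); apply: eq_integral => x _.
  rewrite (ge0_integral_gauss b0 (mhadd x))// -ge0_integralZr//; last 3 first.
  - exact: (emeasurable_funM (mhadd x) (mpdf 0 b)).
  - by move=> y _; rewrite mule_ge0// lee_fin normal_pdf_ge0.
  - by rewrite lee_fin normal_pdf_ge0.
  rewrite [RHS](@integral_affine 1 x (fun y => F (x, y)) (oner_neq0 _)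
    (measurableT_comp mF2 (measurable_pair1 x)) (fun y => F0 _)).
  rewrite normr1 mul1e; apply: eq_integral => y _.
  by rewrite /F/= mul1r addrK [(y + x)%R]addrC EFinM muleA.
rewrite fubini_tonelli// (ge0_integral_gauss c0 mh h0).
apply: eq_integral => y _; rewrite /F/=.
rewrite ge0_integralZl//; last 2 first.
- apply/measurable_EFinP; apply: measurable_funM.
    apply: (measurableT_comp (@measurable_normal_pdf R 0 b)).
    exact: measurable_funB.
  exact: measurable_normal_pdf.
- by move=> x _; rewrite lee_fin mulr_ge0// normal_pdf_ge0.
congr (_ * _)%E.
under eq_integral do rewrite normal_pdf_conv// EFinM.
rewrite ge0_integralZl//; last 3 first.
- exact: mpdf.
- by move=> x _; rewrite lee_fin normal_pdf_ge0.
- by rewrite lee_fin normal_pdf_ge0.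
by rewrite integral_normal_pdf mule1.
Qed.

End gaussian.

(** * Sums of independent Gaussian variables on an event *)

Section sums.
Context {R : realType} d (T : measurableType d) (P : probability T R).

(** Uniqueness of the product measure, applied to [P] restricted to [D], pushed forward by the pair
    and divided by [k], which is [P D]. The event [D] holds the constraints on all variables not
    being merged. *)
Lemma joint_law d1 d2 (T1 : measurableType d1) (T2 : measurableType d2)
    (m1 : probability T1 R) (m2 : probability T2 R)
    (D : set T) (X : T -> T1) (Y : T -> T2) (k : R) :
  measurable D -> measurable_fun setT X -> measurable_fun setT Y ->
  (forall A B, measurable A -> measurable B ->
    P [set w | D w /\ A (X w) /\ B (Y w)] = (k * (fine (m1 A) * fine (m2 B)))%:E) ->
  forall C, measurable C ->
    P [set w | D w /\ C (X w, Y w)] = (k * fine ((m1 \x m2)%E C))%:E.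
Proof.
move=> mD mX mY H C mC.
have PD : P D = k%:E.
  have := H setT setT measurableT measurableT.
  rewrite !probability_setT/= !mulr1 => <-; congr (P _).
  by apply/seteqP; split => w //= -[].
have mXY : measurable_fun setT (fun w => (X w, Y w)).
  exact: measurable_fun_pair.
have mE : measurable [set w | D w /\ C (X w, Y w)].
  rewrite [X in measurable X](_ : _ = D `&` (fun w => (X w, Y w)) @^-1` C)//.
  by apply: measurableI => //; rewrite -[X in measurable X]setTI; exact: mXY.
have k0 : 0 <= k by rewrite -lee_fin -PD.
(* For [k = 0] one cannot normalise, but then [D] is a null set. *)
move: k0; rewrite le_eqVlt => /predU1P[k0|k_gt0].
  rewrite -k0 mul0r; apply/eqP; rewrite eq_le measure_ge0 andbT.
  by rewrite k0 -PD le_measure// ?inE// => w [].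
have k0' : 0 <= k^-1 by rewrite invr_ge0 ltW.
pose m' : {measure set (T1 * T2)%type -> \bar R} :=
  mscale (NngNum k0') (pushm (mrestr P mD) mXY).
have -> : (m1 \x m2)%E C = m' C.
  apply: product_measure_unique => // A B mA mB.
  rewrite /m'/= /mscale/= /pushforward /mrestr.
  rewrite [X in P X](_ : _ = [set w | D w /\ A (X w) /\ B (Y w)]).
    rewrite H// -EFinM mulrA mulVf ?gt_eqF// mul1r EFinM.
    by rewrite !fineK// fin_num_measure.
  by apply/seteqP; split => w /=; tauto.
rewrite /m'/= /mscale/= /pushforward /mrestr.
rewrite [X in _ = (_ * fine (_ * P X))%:E](_ : _ = [set w | D w /\ C (X w, Y w)]).
  have PE := fin_num_measure P _ mE; by rewrite fineM//= mulrA divff ?gt_eqF// mul1r fineK.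
by apply/seteqP; split => w /=; tauto.
Qed.

Lemma gauss_convE (a b : R) A : measurable A ->
  ((gauss a) \x (gauss b))%E [set z : R * R | A (z.1 + z.2)] =
  gauss (Num.sqrt (a ^+ 2 + b ^+ 2)) A.
Proof.
move=> mA.
have m1 : measurable_fun setT (fun x => (\1_A x : R)%:E).
  by apply/measurable_EFinP; exact: measurable_indic.
have h0 x : (0 <= (\1_A x : R)%:E)%E by rewrite lee_fin.
have := gauss_conv a b m1 h0.
rewrite [RHS]integral_indic// setIT => <-.
rewrite /product_measure1; apply: eq_integral => x _ /=.
rewrite [RHS](_ : _ = \int[gauss b]_y (\1_((fun y => (x + y)%R) @^-1` A) y)%:E)%E//.
rewrite integral_indic// ?setIT.
  by congr (gauss b _); apply/seteqP; split => y; rewrite /xsection/= ?inE.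
by rewrite -[X in measurable X]setTI; apply: measurable_funD.
Qed.

Lemma law_addr (D : set T) (X Y : T -> R) (k a b : R) :
  measurable D -> measurable_fun setT X -> measurable_fun setT Y ->
  (forall A B, measurable A -> measurable B ->
    P [set w | D w /\ A (X w) /\ B (Y w)] =
    (k * (fine (gauss a A) * fine (gauss b B)))%:E) ->
  forall C, measurable C -> P [set w | D w /\ C (X w + Y w)] =
    (k * fine (gauss (Num.sqrt (a ^+ 2 + b ^+ 2)) C))%:E.
Proof.
move=> mD mX mY H C mC; rewrite -gauss_convE//.
rewrite -(joint_law mD mX mY H)//.
rewrite -[X in measurable X]setTI.
exact: (measurable_funD measurable_fst measurable_snd).
Qed.

Lemma measurable_forall (I : finType) (Y : I -> T -> R) (B : I -> set R) :
  (forall i, measurable_fun setT (Y i)) -> (forall i, measurable (B i)) ->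
  measurable [set w | forall i, B i (Y i w)].
Proof.
move=> mY mB.
rewrite [X in measurable X](_ : _ = \big[setI/setT]_i (Y i @^-1` B i)).
  apply: bigsetI_measurable => i _; rewrite -[X in measurable X]setTI.
  exact: mY.
rewrite -bigcap_seq; apply/seteqP; split => w /= H i; first by move=> _; exact: H.
by apply: (H i) => /=; rewrite mem_index_enum.
Qed.

(** [X] is an accumulator: the induction adds [Y ord0] to it, with the constraints on the other
    [Y i] moved into [D] and their probabilities into [k]. *)
Lemma law_sum_ord n (Y : 'I_n -> T -> R) (t : 'I_n -> R) (X : T -> R) (a k : R) (D : set T) :
  measurable D -> measurable_fun setT X -> (forall i, measurable_fun setT (Y i)) ->
  (forall A B, measurable A -> (forall i, measurable (B i)) ->
    P [set w | D w /\ A (X w) /\ forall i, B i (Y i w)] =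
    (k * fine (gauss a A) * \prod_(i < n) fine (gauss (t i) (B i)))%:E) ->
  forall C, measurable C -> P [set w | D w /\ C (X w + \sum_(i < n) Y i w)] =
    (k * fine (gauss (Num.sqrt (a ^+ 2 + \sum_(i < n) t i ^+ 2)) C))%:E.
Proof.
elim: n Y t X a k => [|n IH] Y t X a k mD mX mY H C mC.
  have := H C (fun=> setT) mC (fun=> measurableT).
  rewrite !big_ord0 addr0 mulr1 sqrtr_sqr.
  have -> : fine (gauss `|a| C) = fine (gauss a C).
    have m1 : measurable_fun setT (fun x => (\1_C x : R)%:E).
      by apply/measurable_EFinP; exact: measurable_indic.
    have h0 x : (0 <= (\1_C x : R)%:E)%E by rewrite lee_fin.
    have := integral_gauss_abs a m1 h0.
    by rewrite !integral_indic// setIT => ->.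
  move=> <-; congr (P _); apply/seteqP; split => w /=.
    by rewrite big_ord0 addr0 => -[? ?]; split => //; split => // -[].
  by rewrite big_ord0 addr0 => -[? []].
have := IH (fun i => Y (lift ord0 i)) (fun i => t (lift ord0 i))
  (fun w => X w + Y ord0 w) (Num.sqrt (a ^+ 2 + t ord0 ^+ 2)) k mD _ _ _ C mC.
rewrite sqr_sqrtr ?addr_ge0 ?sqr_ge0//.
rewrite [in X in _ -> X]big_ord_recl [in X in _ -> X]addrA.
move=> /(_ (measurable_funD mX (mY _)) (fun i => mY _)) <-.
  by congr (P _); apply/seteqP; split => w /=; rewrite big_ord_recl addrA.
move=> A B mA mB.
rewrite [X in P X](_ : _ = [set w | (D `&` [set w | forall i, B i (Y (lift ord0 i) w)]) w /\
   A (X w + Y ord0 w)]); last by apply/seteqP; split => w /=; tauto.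
rewrite (@law_addr _ X (Y ord0) (k * \prod_(i < n) fine (gauss (t (lift ord0 i)) (B i))) a (t ord0))//.
- by rewrite mulrAC.
- by apply: measurableI => //; exact: measurable_forall.
move=> A1 A2 mA1 mA2.
pose B' i := if unlift ord0 i is Some j then B j else A2.
have B'0 : B' ord0 = A2 by rewrite /B' unlift_none.
have B'l i : B' (lift ord0 i) = B i by rewrite /B' liftK.
have := H A1 B' mA1; rewrite big_ord_recl B'0.
under eq_bigr do rewrite B'l.
rewrite [in X in _ -> X](_ : _ * (_ * _) = k * fine (gauss a A1) * (fine (gauss (t ord0) A2) *
       \prod_(i < n) fine (gauss (t (lift ord0 i)) (B i)))); last by ring.
move=> <-; last first.
  by move=> i; have [j ->|->] := unliftP ord0 i; rewrite ?B'l ?B'0.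
congr (P _); apply/seteqP; split => w /=.
  move=> [[Dw Bw] [A1w A2w]]; split => //; split => // i.
  by have [j ->|->] := unliftP ord0 i; rewrite ?B'l ?B'0.
move=> [Dw [A1w B'w]]; split; last by split => //; rewrite -B'0.
by split => // i; rewrite -B'l.
Qed.

Lemma gauss0E (A : set R) : gauss 0 A = (\1_A 0)%:E.
Proof.
rewrite /gauss /pushforward indicE.
have [A0|A0] := boolP (0 \in A).
  rewrite (_ : _ @^-1` _ = setT) ?probability_setT//.
  by apply/seteqP; split => x //= _; rewrite mul0r; exact/set_mem.
rewrite (_ : _ @^-1` _ = set0) ?measure0//.
by apply/seteqP; split => x //=; rewrite mul0r => /mem_set; rewrite (negbTE A0).
Qed.

(** The accumulator starts at the constant 0, whose law is the Dirac mass [gauss 0]. *)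
Lemma law_sum (I : finType) (Y : I -> T -> R) (t : I -> R) (k : R) (D : set T) :
  measurable D -> (forall i, measurable_fun setT (Y i)) ->
  (forall B, (forall i, measurable (B i)) ->
    P [set w | D w /\ forall i, B i (Y i w)] =
    (k * \prod_i fine (gauss (t i) (B i)))%:E) ->
  forall C, measurable C -> P [set w | D w /\ C (\sum_i Y i w)] =
    (k * fine (gauss (Num.sqrt (\sum_i t i ^+ 2)) C))%:E.
Proof.
move=> mD mY H C mC.
have E (F : I -> R) : \sum_i F i = \sum_(j < #|I|) F (enum_val j).
  by rewrite (reindex (@enum_val I I)) //; exact: onW_bij (enum_val_bij _).
have := @law_sum_ord #|I| (fun j => Y (enum_val j)) (fun j => t (enum_val j)) (cst 0) 0 k D
  mD _ (fun j => mY _) _ C mC.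
rewrite expr0n add0r -(E (fun i => t i ^+ 2)) => <- //.
- by congr (P _); apply/seteqP; split => w /=; rewrite add0r E.
move=> A B mA mB.
have := H (fun i => B (enum_rank i)) (fun i => mB _).
have -> : \prod_i fine (gauss (t i) (B (enum_rank i))) =
    \prod_(j < #|I|) fine (gauss (t (enum_val j)) (B j)).
  rewrite (reindex (@enum_val I I)); last exact: onW_bij (enum_val_bij _).
  by apply: eq_bigr => j _; rewrite enum_valK.
move=> HB; rewrite gauss0E/= indicE.
have [A0|A0] := boolP (0 \in A); rewrite ?mulr1 ?mulr0 ?mul0r.
  rewrite -HB; congr (P _); apply/seteqP; split => w /=.
    by move=> [Dw [_ Bw]]; split => // i; have := Bw (enum_rank i); rewrite enum_rankK.
  move=> [Dw Bw]; split => //; split; first exact/set_mem.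
  by move=> i; have := Bw (enum_val i); rewrite enum_valK.
rewrite [X in P X](_ : _ = set0) ?measure0//.
by apply/seteqP; split => w //= [_ []] /mem_set; rewrite (negbTE A0).
Qed.

End sums.

(** * Mutual information through a log-likelihood ratio *)

Section mutual_information.
Context {R : realType} d dX dY (T : measurableType d) (X : measurableType dX)
  (Y : measurableType dY) (Q : probability T R).

Lemma Rintegral_partition (K : finType) (k : T -> K) (F : T -> R) :
  (forall i, measurable (k @^-1` [set i])) ->
  Q.-integrable setT (EFin \o F) ->
  \int[Q]_w F w = \sum_i \int[Q]_(w in k @^-1` [set i]) F w.
Proof.
move=> mk iF.
have U : \big[setU/set0]_(i : K) (k @^-1` [set i]) = setT.
  apply/seteqP; split => w //= _.
  by rewrite -bigcup_seq; exists (k w) => //=; rewrite mem_index_enum.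
have mF : measurable_fun setT (EFin \o F) by case/integrableP : iF.
rewrite /Rintegral -[in LHS]U integral_bigsetU_EFin//.
- rewrite -sum_fine// => i _.
  apply: integrable_fin_num => //.
  exact: (integrableS measurableT).
- exact: index_enum_uniq.
- by apply: trivIset_preimage1.
- by rewrite U.
Qed.

Lemma measurable_fun_finite (K : finType) (k : T -> K) (F : K -> R) :
  (forall i, measurable (k @^-1` [set i])) -> measurable_fun setT (F \o k).
Proof.
move=> mk _ D mD; rewrite setTI.
rewrite (_ : _ @^-1` D = \big[setU/set0]_(i | `[< D (F i) >]) (k @^-1` [set i])).
  exact: bigsetU_measurable.
rewrite -bigcup_seq_cond; apply/seteqP; split => w /=.
  by move=> Dw; exists (k w) => //=; rewrite mem_index_enum; apply/asboolP.
by move=> [i /= /andP[_ /asboolP Di] ki]; rewrite ki.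
Qed.

Variables (f : T -> X) (g : T -> Y) (phi : T -> R).
Hypotheses (mf : measurable_fun setT f) (mg : measurable_fun setT g).
Hypothesis iphi : Q.-integrable setT (EFin \o phi).
(** In other words, [exp (- phi)] is the density of the product of the marginals with respect to the
    joint law, so [phi] is the log-likelihood ratio in nats. *)
Hypothesis tilt : forall A B, measurable A -> measurable B ->
  (\int[Q]_(w in f @^-1` A `&` g @^-1` B) (expR (- phi w))%:E =
   Q (f @^-1` A) * Q (g @^-1` B))%E.

Let mphi : measurable_fun setT phi.
Proof. by case/integrableP : iphi => /measurable_EFinP. Qed.

Let mexp : measurable_fun setT (fun w => expR (- phi w)).
Proof. by apply: measurableT_comp => //; exact: measurableT_comp. Qed.

Lemma integrable_expRN : Q.-integrable setT (fun w => (expR (- phi w))%:E).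
Proof.
apply/integrableP; split; first exact/measurable_EFinP.
under eq_integral do rewrite gee0_abs ?lee_fin ?expR_ge0//.
have := tilt measurableT measurableT.
by rewrite !preimage_setT setIT probability_setT mule1 => ->; rewrite ltry.
Qed.

Let mpre A B : measurable A -> measurable B -> measurable (f @^-1` A `&` g @^-1` B).
Proof.
by move=> mA mB; apply: measurableI; rewrite -[X in measurable X]setTI; [exact: mf|exact: mg].
Qed.

Let mfA A : measurable A -> measurable (f @^-1` A).
Proof. by move=> mA; rewrite -[X in measurable X]setTI; exact: mf. Qed.
Let mgB B : measurable B -> measurable (g @^-1` B).
Proof. by move=> mB; rewrite -[X in measurable X]setTI; exact: mg. Qed.

Let tiltR A B : measurable A -> measurable B ->
  \int[Q]_(w in f @^-1` A `&` g @^-1` B) expR (- phi w) =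
  fine (Q (f @^-1` A)) * fine (Q (g @^-1` B)).
Proof.
move=> mA mB; rewrite /Rintegral tilt// fineM// fin_num_measure//.
- exact: mfA.
- exact: mgB.
Qed.

(* Jensen on a cell, from [e^u >= 1 + u] at [u = ln (p / (a b)) - phi] *)
Lemma kl_term_le A B : measurable A -> measurable B ->
  kl_term (fine (Q (f @^-1` A `&` g @^-1` B))) (fine (Q (f @^-1` A)))
    (fine (Q (g @^-1` B))) <=
  (\int[Q]_(w in f @^-1` A `&` g @^-1` B) phi w) / ln 2.
Proof.
move=> mA mB; have mC := mpre mA mB.
set C := f @^-1` A `&` g @^-1` B in mC *.
set p := fine (Q C); set a := fine (Q (f @^-1` A)); set b := fine (Q (g @^-1` B)).
have ln2 : 0 < ln (2 : R) by rewrite ln_gt0 ?ltr1n.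
rewrite /kl_term; case: ifPn => [/eqP p0|p0].
  have QC : Q C = 0%E by rewrite -[Q C]fineK ?fin_num_measure// -/p p0.
  rewrite /Rintegral null_set_integral ?mul0r//.
  by apply/measurable_EFinP; exact: measurable_funTS.
have p_gt0 : 0 < p by rewrite lt_neqAle eq_sym p0 fine_ge0.
(* The cell lies in both preimages, so [a] and [b] are at least [p] and no division by 0 occurs. *)
have a_gt0 : 0 < a.
  apply: (lt_le_trans p_gt0); apply: fine_le; rewrite ?fin_num_measure//; first exact: mfA.
  by apply: le_measure; rewrite ?inE; [exact: mC|exact: mfA|exact: subIsetl].
have b_gt0 : 0 < b.
  apply: (lt_le_trans p_gt0); apply: fine_le; rewrite ?fin_num_measure//; first exact: mgB.
  by apply: le_measure; rewrite ?inE; [exact: mC|exact: mgB|exact: subIsetr].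
rewrite /log2 mulrA ler_pM2r ?invr_gt0//.
set t := p / (a * b).
have t_gt0 : 0 < t by rewrite divr_gt0// mulr_gt0.
have iC : Q.-integrable C (EFin \o phi) by exact: (integrableS measurableT).
have ie : Q.-integrable C (EFin \o (fun w => expR (- phi w))).
  by apply: (integrableS measurableT) => //; exact: integrable_expRN.
have icst (r : R) : Q.-integrable C (EFin \o cst r).
  by apply: finite_measure_integrable_cst.
(* By [tilt] the right-hand side equals [t a b = p]. This cancels the integral of 1 on the left,
   leaving [p ln t] at most the integral of [phi]. *)
have : \int[Q]_(w in C) (1 + ln t - phi w) <= \int[Q]_(w in C) (t * expR (- phi w)).
  apply: le_Rintegral => //.
  - apply: (@integrableB _ _ _ _ _ _ (EFin \o cst (1 + ln t)) (EFin \o phi)) => //.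
  - apply: (eq_integrable mC (fun w => t%:E * (expR (- phi w))%:E)%E) => //.
    exact: integrableZl.
  move=> w _; rewrite -{2}[t]lnK ?posrE// -expRD.
  by apply: le_trans (expR_ge1Dx _); rewrite addrA.
rewrite RintegralZl// tiltR// RintegralB//; last exact: icst.
rewrite Rintegral_cst// -/p -/a -/b.
rewrite (_ : t * (a * b) = p); last by rewrite divfK// gt_eqF// mulr_gt0.
by rewrite mulrDl mul1r; set I := Rintegral _ _ _; rewrite [_ * ln _]mulrC; lra.
Qed.

Lemma mpartition_index d' (Z : measurableType d') n (A : 'I_n -> set Z) :
  is_mpartition A -> exists k : Z -> 'I_n, forall i, A i = k @^-1` [set i].
Proof.
move=> [mA [dA cA]]; exists (fun x => sval (cid (cA x))) => i.
apply/seteqP; split => x /=; case: cid => j /= Aj; last by move=> <-.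
move=> Ai; apply/eqP/negP => /negP ji.
by have := dA _ _ ji; move/seteqP => [/(_ x) + _]; apply.
Qed.

Lemma mutual_info_le : (mutual_info Q f g <= ((\int[Q]_w phi w) / ln 2)%:E)%E.
Proof.
apply: ge_ereal_sup => _ [n [m [A [B [pA [pB ->]]]]]].
have [mA [_ _]] := pA; have [mB [_ _]] := pB.
have [kf kfE] := mpartition_index pA; have [kg kgE] := mpartition_index pB.
rewrite lee_fin.
apply: (@le_trans _ _ (\sum_(i < n) \sum_(j < m)
   (\int[Q]_(w in f @^-1` A i `&` g @^-1` B j) phi w) / ln 2)).
  by apply: ler_sum => i _; apply: ler_sum => j _; exact: kl_term_le.
have kE i j : f @^-1` A i `&` g @^-1` B j =
    (fun w => (kf (f w), kg (g w))) @^-1` [set (i, j)].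
  by rewrite kfE kgE; apply/seteqP; split => w /= [-> ->].
rewrite (Rintegral_partition (k := fun w => (kf (f w), kg (g w))))//; last first.
  by move=> [i j]; rewrite -kE; exact: mpre.
rewrite pair_big/= mulr_suml; apply: ler_sum => -[i j] _ /=.
by rewrite kE.
Qed.

(* from [ln u >= 1 - 1/u] at [u = p / (a b e^c)] *)
Lemma kl_term_ge (p a b c : R) : 0 <= p -> 0 <= a -> 0 <= b ->
  (p != 0 -> 0 < a * b) ->
  (p * c + p - expR c * (a * b)) / ln 2 <= kl_term p a b.
Proof.
move=> p0 a0 b0 H; rewrite /kl_term; have ln2 : 0 < ln (2 : R) by rewrite ln_gt0 ?ltr1n.
case: ifPn => [/eqP ->|pn0].
  by rewrite mul0r !add0r mulNr oppr_le0 !mulr_ge0 ?expR_ge0// invr_ge0 ltW.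
have p_gt0 : 0 < p by rewrite lt_neqAle eq_sym pn0.
have ab := H pn0; rewrite /log2 [leRHS]mulrA ler_pM2r ?invr_gt0//.
have cab : 0 < expR c * (a * b) by rewrite mulr_gt0// expR_gt0.
have u_gt0 : 0 < expR c * (a * b) / p by rewrite divr_gt0.
have := expR_ge1Dx (ln (expR c * (a * b) / p)); rewrite lnK ?posrE//.
rewrite (_ : ln (expR c * (a * b) / p) = c + ln (a * b) - ln p); last first.
  by rewrite ln_div ?posrE// lnM ?posrE ?expR_gt0// expRK.
rewrite (_ : ln (p / (a * b)) = ln p - ln (a * b)); last by rewrite ln_div ?posrE.
move=> /(ler_wpM2l p0).
rewrite [X in _ <= X -> _](_ : _ = expR c * (a * b)); last by rewrite mulrC divfK.
by set x := ln p; set y := ln _; set z := expR _ * _; nra.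
Qed.

(** The variational lower bound for relative entropy, with a test function [c] constant on the
    cells: integrating [exp (c - phi)] under [Q] is integrating [exp c] under the product of the
    marginals. As [c] approaches [phi] the last integral approaches 1 and the bound becomes
    sharp. *)
Lemma mutual_info_ge (I J : finType) (kf : X -> I) (kg : Y -> J) (c : I -> J -> R) :
  (forall i, measurable (kf @^-1` [set i])) ->
  (forall j, measurable (kg @^-1` [set j])) ->
  (((\int[Q]_w c (kf (f w)) (kg (g w)) + 1 -
     \int[Q]_w expR (c (kf (f w)) (kg (g w)) - phi w)) / ln 2)%:E
   <= mutual_info Q f g)%E.
Proof.
move=> mkf mkg.
pose A (i : 'I_#|I|) := kf @^-1` [set enum_val i].
pose B (j : 'I_#|J|) := kg @^-1` [set enum_val j].
have pA : is_mpartition A.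
  split; first by move=> i; exact: mkf.
  split; last by move=> x; exists (enum_rank (kf x)); rewrite /A/= enum_rankK.
  move=> i j ij; apply/seteqP; split => x //= [Hi Hj].
  by rewrite (enum_val_inj (etrans (esym Hi) Hj)) eqxx in ij.
have pB : is_mpartition B.
  split; first by move=> i; exact: mkg.
  split; last by move=> x; exists (enum_rank (kg x)); rewrite /B/= enum_rankK.
  move=> i j ij; apply/seteqP; split => x //= [Hi Hj].
  by rewrite (enum_val_inj (etrans (esym Hi) Hj)) eqxx in ij.
apply: le_trans; last first.
  by apply: ereal_sup_ubound; exists #|I|, #|J|, A, B; split => //; split.
rewrite lee_fin.
pose k w := (kf (f w), kg (g w)).
have kE i j : k @^-1` [set (i, j)] = f @^-1` (kf @^-1` [set i]) `&` g @^-1` (kg @^-1` [set j]).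
  by rewrite /k; apply/seteqP; split => w /= [-> ->].
have mk ij : measurable (k @^-1` [set ij]).
  by case: ij => i j; rewrite kE; exact: mpre.
have reidx (F : I -> J -> R) : \sum_(i < #|I|) \sum_(j < #|J|) F (enum_val i) (enum_val j) =
    \sum_i \sum_j F i j.
  rewrite [RHS](reindex (@enum_val I I)) /=; last exact: onW_bij (enum_val_bij _).
  apply: eq_bigr => i _.
  by rewrite [RHS](reindex (@enum_val J J)) //=; exact: onW_bij (enum_val_bij _).
rewrite (reidx (fun i j => kl_term
  (fine (Q (f @^-1` (kf @^-1` [set i]) `&` g @^-1` (kg @^-1` [set j]))))
  (fine (Q (f @^-1` (kf @^-1` [set i])))) (fine (Q (g @^-1` (kg @^-1` [set j])))))).
have mc : measurable_fun setT (fun w => c (k w).1 (k w).2).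
  exact: (@measurable_fun_finite _ k (fun ij => c ij.1 ij.2)).
(* A crude bound, available because there are finitely many cells; it makes [exp (c - phi)]
   integrable by comparison with [exp (- phi)]. *)
have [M cM] : exists M, forall i j, `|c i j| <= M.
  exists (\sum_i \sum_j `|c i j|) => i j.
  rewrite (bigD1 i)//= (bigD1 j)//= -addrA lerDl addr_ge0// sumr_ge0// => i' _.
  exact: sumr_ge0.
have ic : Q.-integrable setT (EFin \o (fun w => c (k w).1 (k w).2)).
  apply: (@le_integrable _ _ _ Q setT measurableT _ (EFin \o cst M)).
  - exact/measurable_EFinP.
  - by move=> w _; rewrite /= lee_fin (le_trans (cM _ _)) ?ler_norm.
  - exact: finite_measure_integrable_cst.
have ie : Q.-integrable setT (EFin \o (fun w => expR (c (k w).1 (k w).2 - phi w))).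
  apply: (@le_integrable _ _ _ Q setT measurableT _ (fun w => (expR M)%:E * (expR (- phi w))%:E)%E).
  - apply/measurable_EFinP; apply: measurableT_comp => //; exact: measurable_funB.
  - move=> w _; rewrite /= lee_fin -expRD !ger0_norm ?expR_ge0// ler_expR lerD2r.
    exact: le_trans (ler_norm _) (cM _ _).
  - apply: integrableZl => //; exact: integrable_expRN.
rewrite (Rintegral_partition mk ic) (Rintegral_partition mk ie).
(* The constant 1 is spread over the cells as their probabilities, so that [kl_term_ge] applies term
   by term. *)
have sum1 : 1 = \sum_ij \int[Q]_(w in k @^-1` [set ij]) 1 :> R.
  rewrite -Rintegral_partition//; last exact: finite_measure_integrable_cst.
  rewrite Rintegral_cst// mul1r [X in fine X](_ : _ = 1%E)//.
  exact: probability_setT.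
rewrite [X in _ + X - _]sum1.
rewrite -big_split/= -sumrB mulr_suml (pair_big xpredT xpredT)/=.
apply: ler_sum => -[i j] _ /=.
have -> : \int[Q]_(w in k @^-1` [set (i, j)]) c (kf (f w)) (kg (g w)) =
    c i j * fine (Q (k @^-1` [set (i, j)])).
  rewrite -Rintegral_cst//; apply: eq_Rintegral => w.
  by rewrite inE /k/= => -[-> ->].
rewrite Rintegral_cst// [X in _ - X](_ : _ = expR (c i j) *
    (fine (Q (f @^-1` (kf @^-1` [set i]))) * fine (Q (g @^-1` (kg @^-1` [set j]))))).
  rewrite mul1r [c i j * _]mulrC kE; apply: kl_term_ge; rewrite ?fine_ge0//.
  move=> pn0.
  have mC := mpre (mkf i) (mkg j).
  set p := fine _ in pn0; have p_gt0 : 0 < p by rewrite lt_neqAle eq_sym pn0 fine_ge0.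
  apply: mulr_gt0; apply: (lt_le_trans p_gt0); apply: fine_le; rewrite ?fin_num_measure//;
    try exact: mfA; try exact: mgB; apply: le_measure; rewrite ?inE//;
    try exact: mfA; try exact: mgB; by [exact: subIsetl|exact: subIsetr].
rewrite -tiltR// -kE -RintegralZl//.
  by apply: eq_Rintegral => w; rewrite inE /k/= => -[-> ->]; rewrite expRD.
by apply: (integrableS measurableT) => //; exact: integrable_expRN.
Qed.

(** Dominated convergence in both integrals of [mutual_info_ge]. The two-sided bound on [c]
    dominates the first one by [|phi| + 1]. In the second it would allow [exp (- 2 phi)] where [phi]
    is negative; the last hypothesis gives [c <= 0] or [c - phi <= 1], hence the integrable bound
    [exp 1 + exp (- phi)]. *)
Lemma mutual_infoE (I J : nat -> finType) (kf : forall n, X -> I n) (kg : forall n, Y -> J n)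
    (c : forall n, I n -> J n -> R) :
  (forall n i, measurable (kf n @^-1` [set i])) ->
  (forall n j, measurable (kg n @^-1` [set j])) ->
  (forall w, (fun n => c n (kf n (f w)) (kg n (g w))) @ \oo --> phi w) ->
  (forall n w, `|c n (kf n (f w)) (kg n (g w))| <= `|phi w| + 1) ->
  (forall n w, c n (kf n (f w)) (kg n (g w)) <= Num.max 0 (phi w + 1)) ->
  mutual_info Q f g = ((\int[Q]_w phi w) / ln 2)%:E.
Proof.
move=> mkf mkg cvgc domc dome; 
apply/eqP; rewrite eq_le mutual_info_le/=.
pose cw n w := c n (kf n (f w)) (kg n (g w)).
have mc n : measurable_fun setT (cw n).
  apply: (@measurable_fun_finite _ (fun w => (kf n (f w), kg n (g w))) (fun ij => c n ij.1 ij.2)) => -[i j].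
  rewrite (_ : _ @^-1` _ = f @^-1` (kf n @^-1` [set i]) `&` g @^-1` (kg n @^-1` [set j])).
    exact: mpre.
  by apply/seteqP; split => w /= [-> ->].
have mce n : measurable_fun setT (fun w => expR (cw n w - phi w)).
  by apply: measurableT_comp => //; exact: measurable_funB.
have i1 (r : R) : Q.-integrable setT (EFin \o cst r) by exact: finite_measure_integrable_cst.

have [_ _ cvg1] : [/\ Q.-integrable setT (EFin \o phi),
    [sequence \int[Q]_w `|(cw n w)%:E - (phi w)%:E|]_n @ \oo --> 0%E &
    [sequence \int[Q]_w (cw n w)%:E]_n @ \oo --> \int[Q]_w (phi w)%:E]%E.
  apply: (@dominated_convergence _ _ _ Q setT measurableT
    (fun n => EFin \o cw n) (EFin \o phi) (fun w => (`|phi w|%:E + 1%:E)%E)).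
  - by move=> n; apply/measurable_EFinP.
  - exact/measurable_EFinP.
  - apply: aeW => w _; apply: cvg_EFin; first exact: nearW.
    exact: cvgc.
  - apply: integrableD => //; last exact: i1.
    exact: (integrable_abse iphi).
  - by apply: aeW => w n _; rewrite lee_fin; exact: domc.
have [_ _ cvg2] : [/\ Q.-integrable setT (fun w => 1%:E),
    [sequence \int[Q]_w `|(expR (cw n w - phi w))%:E - 1%:E|]_n @ \oo --> 0%E &
    [sequence \int[Q]_w (expR (cw n w - phi w))%:E]_n @ \oo --> \int[Q]_w (1%:E)]%E.
  apply: (@dominated_convergence _ _ _ Q setT measurableT
    (fun n w => (expR (cw n w - phi w))%:E) (fun w => 1%:E)
    (fun w => ((expR 1)%:E + (expR (- phi w))%:E)%E)).
  - by move=> n; apply/measurable_EFinP.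
  - exact: measurable_cst.
  - apply: aeW => w _; apply: cvg_EFin; first exact: nearW.
    rewrite -[X in _ --> X]expR0 -(subrr (phi w)).
    apply: (cvg_comp _ expR); last exact: continuous_expR.
    by apply: cvgB; [exact: cvgc|exact: cvg_cst].
  - apply: integrableD => //; first exact: i1.
    exact: integrable_expRN.
  - apply: aeW => w n _; rewrite -EFinD lee_fin ger0_norm ?expR_ge0//.
    have := dome n w; rewrite -/(cw n w) le_max => /orP[c0|c1].
      apply: (@le_trans _ _ (expR (- phi w))); last by rewrite lerDr expR_ge0.
      by rewrite ler_expR gerDr.
    apply: (@le_trans _ _ (expR 1)); last by rewrite lerDl expR_ge0.
    by rewrite ler_expR lerBlDl.
pose v n := (\int[Q]_w cw n w + 1 - \int[Q]_w expR (cw n w - phi w)) / ln 2.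
apply: (@cvge_to_le _ \oo _ _ (fun n => (v n)%:E)); last first.
  by apply: nearW => n; exact: (mutual_info_ge (c n) (mkf n) (mkg n)).
apply: cvg_EFin; first exact: nearW.
rewrite [X in _ --> X](_ : _ = (\int[Q]_w phi w + 1 - 1) / ln 2); last by rewrite addrK.
apply: cvgM; last exact: cvg_cst.
apply: cvgB; [apply: cvgD; last exact: cvg_cst|].
  apply: fine_cvg; rewrite /Rintegral fineK//.
  exact: integrable_fin_num.
apply: fine_cvg.
move: cvg2; rewrite integral_cst// mul1e.
have <- : Q setT = 1%E by exact: probability_setT.
exact.
Qed.

End mutual_information.

(** * The Gaussian channel *)

Section second_moment.
Context {R : realType}.
Local Notation mu := (@lebesgue_measure R).

(** The standard density times [x ^+ 2] is dominated by a multiple of the density of standard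
    deviation 2. *)
Lemma gauss_sqr_lty : (\int[gauss (1 : R)]_x (x ^+ 2)%:E < +oo)%E.
Proof.
have m2 : measurable_fun [set: R] (fun x : R => (x ^+ 2)%:E).
  by apply/measurable_EFinP; exact: measurable_funX.
have sq0 x : (0 <= (x ^+ 2 : R)%:E)%E by rewrite lee_fin sqr_ge0.
rewrite (ge0_integral_gauss (oner_neq0 R) m2 sq0).
have p1 : 0 < normal_peak (1 : R) by rewrite normal_peak_gt0 ?oner_neq0.
have p2 : 0 < normal_peak (2 : R) by rewrite normal_peak_gt0// pnatr_eq0.
(* The ratio of the exponentials is [exp (3 x^2 / 8)], at least [3 x^2 / 8]; this gives the factor
   [8 / 3]. *)
pose C : R := 8 / 3 * normal_peak 1 / normal_peak 2.
have C0 : 0 <= C by rewrite /C !mulr_ge0 ?invr_ge0 ?(ltW p1) ?(ltW p2).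
have mpdf m s : measurable_fun [set: measurableTypeR R] (fun x => (normal_pdf m s x)%:E).
  by apply/measurable_EFinP; exact: measurable_normal_pdf.
apply: (@le_lt_trans _ _ (\int[mu]_x (C%:E * (normal_pdf 0 2 x)%:E))%E).
  apply: ge0_le_integral => //.
  - by move=> x _; rewrite lee_fin mulr_ge0 ?sqr_ge0 ?normal_pdf_ge0.
  - exact: (emeasurable_funM m2 (mpdf 0 1)).
  - exact: (emeasurable_funM (measurable_cst _) (mpdf 0 2)).
  move=> x _; rewrite -!EFinM lee_fin.
  rewrite !normal_pdfE ?oner_neq0 ?pnatr_eq0// /normal_fun !subr0 expr1n.
  rewrite /C [leRHS]mulrA divfK ?gt_eqF// [leRHS]mulrAC [leLHS]mulrCA [leRHS]mulrC.
  rewrite ler_pM2l//.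
  have -> : expR (- x ^+ 2 / (2 ^+ 2 *+ 2)) =
      expR (3 / 8 * x ^+ 2) * expR (- x ^+ 2 / (1 *+ 2)).
    by rewrite -expRD; congr expR; field.
  rewrite mulrA ler_pM2r ?expR_gt0//.
  have := expR_ge1Dx (3 / 8 * x ^+ 2); have := sqr_ge0 x.
  by set u := x ^+ 2; set v := expR _; lra.
rewrite ge0_integralZl//.
- by rewrite integral_normal_pdf mule1 ltry.
- by move=> x _; rewrite lee_fin normal_pdf_ge0.
Qed.

Lemma integral_gauss_sqr s :
  (\int[gauss s]_x (x ^+ 2)%:E = (s ^+ 2)%:E * \int[gauss (1 : R)]_x (x ^+ 2)%:E)%E.
Proof.
have m2 : measurable_fun [set: R] (fun x : R => (x ^+ 2)%:E).
  by apply/measurable_EFinP; exact: measurable_funX.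
have sq0 x : (0 <= (x ^+ 2 : R)%:E)%E by rewrite lee_fin sqr_ge0.
rewrite !(ge0_integral_gauss1 _ m2 sq0) -ge0_integralZl//.
- by apply: eq_integral => x _; rewrite mul1r exprMn EFinM.
- by apply/measurable_EFinP; apply: measurable_funX; exact: measurable_funM.
Qed.

End second_moment.

Section channel.
Context {R : realType} (e s : R).
Hypotheses (e0 : 0 < e) (s0 : 0 < s).
Local Notation mu := (@lebesgue_measure R).
Let t := Num.sqrt (e ^+ 2 + s ^+ 2).

Let t_gt0 : 0 < t.
Proof. by rewrite sqrtr_gt0 addr_gt0// exprn_gt0. Qed.
Let t2 : t ^+ 2 = e ^+ 2 + s ^+ 2.
Proof. by rewrite sqr_sqrtr// addr_ge0// sqr_ge0. Qed.

(* log-likelihood ratio of the pair (y, y - w) against independent copies *)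
Definition llr (y w : R) : R :=
  ln (t / s) + y ^+ 2 / (2 * t ^+ 2) - w ^+ 2 / (2 * s ^+ 2).

Let measurable_llr d (T : measurableType d) (Y W : T -> R) :
  measurable_fun setT Y -> measurable_fun setT W ->
  measurable_fun setT (fun x => llr (Y x) (W x)).
Proof.
move=> mY mW; apply: measurable_funB.
  apply: measurable_funD => //; apply: measurable_funM => //.
  exact: measurable_funX.
by apply: measurable_funM => //; exact: measurable_funX.
Qed.

Let measurable_expllr d (T : measurableType d) (Y W : T -> R) :
  measurable_fun setT Y -> measurable_fun setT W ->
  measurable_fun setT (fun x => (expR (- llr (Y x) (W x)))%:E).
Proof.
move=> mY mW; apply/measurable_EFinP; apply: measurableT_comp => //.
by apply: measurableT_comp => //; exact: measurable_llr.
Qed.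

Lemma normal_pdf_llr y w :
  expR (- llr y w) * normal_pdf 0 s w = normal_pdf 0 t y.
Proof.
rewrite !normal_pdfE ?gt_eqF// /normal_fun !subr0.
have peakE x : 0 < x -> normal_peak x = x^-1 * (Num.sqrt (pi *+ 2))^-1 :> R.
  move=> x0; rewrite /normal_peak -mulrnAr sqrtrM ?sqr_ge0// sqrtr_sqr.
  by rewrite gtr0_norm// invfM.
have -> : normal_peak t = s / t * normal_peak s.
  by rewrite !peakE// mulrA [s / t]mulrC -(mulrA t^-1) divff ?mulr1// gt_eqF.
rewrite mulrCA mulrC -[RHS]mulrA [RHS]mulrCA -expRD.
have -> : s / t = expR (- ln (t / s)).
  by rewrite expRN lnK ?posrE ?divr_gt0// invf_div.
rewrite -expRD mulrC; congr (_ * expR _).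
rewrite /llr !mulr2n; field.
by rewrite -!mulr2n !mulrn_eq0/= !expf_eq0/= !gt_eqF.
Qed.

(** For every fixed input [b], the weight [exp (- llr)] turns the law of the output [b + w] into its
    marginal law, which no longer depends on [b]. *)
Lemma integral_tilt (h : R -> \bar R) b : measurable_fun setT h ->
  (forall x, 0 <= h x)%E ->
  (\int[gauss s]_w (h (b + w)%R * (expR (- llr (b + w) w))%:E) =
   \int[gauss t]_y h y)%E.
Proof.
move=> mh h0.
have mb : measurable_fun setT (fun w : R => b + w) by exact: measurable_funD.
have mH : measurable_fun setT (fun w : R => h (b + w)%R * (expR (- llr (b + w) w))%:E)%E.
  apply: emeasurable_funM; first exact: (measurableT_comp mh mb).
  by apply: measurable_expllr => //; exact: measurable_id.
have H0 w : (0 <= h (b + w)%R * (expR (- llr (b + w) w))%:E)%E.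
  by rewrite mule_ge0// lee_fin expR_ge0.
have sn0 : s != 0 by rewrite gt_eqF.
have tn0 : t != 0 by rewrite gt_eqF.
rewrite (ge0_integral_gauss sn0 mH H0) (ge0_integral_gauss tn0 mh h0).
have mpdf : measurable_fun [set: R] (fun x => (normal_pdf 0 t x)%:E).
  by apply/measurable_EFinP; exact: measurable_normal_pdf.
have mhp : measurable_fun setT (fun y : R => h y * (normal_pdf 0 t y)%:E)%E.
  exact: (emeasurable_funM mh mpdf).
have hp0 y : (0 <= h y * (normal_pdf 0 t y)%:E)%E.
  by rewrite mule_ge0// lee_fin normal_pdf_ge0.
rewrite [RHS](integral_affine b (oner_neq0 R) mhp hp0) normr1 mul1e.
apply: eq_integral => w _.
by rewrite -muleA -EFinM normal_pdf_llr mul1r addrC.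
Qed.

Definition gauss2 (r : R) : probability (R * R)%type R := (gauss r \x gauss r)%E.

Definition channel_law : probability ((R * R) * (R * R))%type R :=
  (gauss2 e \x gauss2 s)%E.

Lemma ge0_integral_gauss2 r (h : R * R -> \bar R) : measurable_fun setT h ->
  (forall x, 0 <= h x)%E ->
  (\int[gauss2 r]_z h z = \int[gauss r]_x \int[gauss r]_y h (x, y))%E.
Proof. by move=> mh h0; exact: fubini_tonelli1. Qed.

Lemma ge0_integral_channel (h : (R * R) * (R * R) -> \bar R) : measurable_fun setT h ->
  (forall x, 0 <= h x)%E ->
  (\int[channel_law]_z h z = \int[gauss2 e]_x \int[gauss2 s]_y h (x, y))%E.
Proof. by move=> mh h0; exact: fubini_tonelli1. Qed.

Lemma channel_setM A B : measurable A -> measurable B ->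
  channel_law (A `*` B) = (gauss2 e A * gauss2 s B)%E.
Proof. by move=> mA mB; exact: product_measure1E. Qed.

(* unfolding the product measures makes unification diverge *)
Opaque gauss2 channel_law.

Definition chan_out (p : (R * R) * (R * R)) : R * R := (p.1.1 + p.2.1, p.1.2 + p.2.2).
Definition chan_llr (p : (R * R) * (R * R)) : R :=
  llr (p.1.1 + p.2.1) p.2.1 + llr (p.1.2 + p.2.2) p.2.2.

Lemma measurable_chan_out : measurable_fun setT chan_out.
Proof.
apply: measurable_fun_pair; apply: measurable_funD.
- exact: (measurableT_comp measurable_fst measurable_fst).
- exact: (measurableT_comp measurable_fst measurable_snd).
- exact: (measurableT_comp measurable_snd measurable_fst).
- exact: (measurableT_comp measurable_snd measurable_snd).
Qed.


Lemma integral_indic_comp d d' (T : measurableType d) (T' : measurableType d')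
    (m : {measure set T -> \bar R}) (h : T -> T') (A : set T') :
  measurable_fun setT h -> measurable A ->
  (\int[m]_x (\1_A (h x) : R)%:E = m (h @^-1` A))%E.
Proof.
move=> mh mA; have mhA : measurable (h @^-1` A).
  by rewrite -[X in measurable X]setTI; exact: mh.
rewrite -[in RHS](setIT (h @^-1` A)) -integral_indic//.
Qed.

(** The four integrals are regrouped by component, input next to noise, and [gauss_conv] is applied
    to each component. *)
Lemma integral_channel_out (h : R * R -> \bar R) : measurable_fun setT h ->
  (forall y, 0 <= h y)%E ->
  (\int[channel_law]_p h (chan_out p) = \int[gauss2 t]_y h y)%E.
Proof.
move=> mh h0.
have mho := measurableT_comp mh measurable_chan_out.
rewrite [LHS](ge0_integral_channel mho (fun p => h0 _)).
have mpair d (T : measurableType d) (y1 y2 : T -> R) : measurable_fun setT y1 ->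
    measurable_fun setT y2 -> measurable_fun setT (fun x => h (y1 x, y2 x)).
  by move=> m1 m2; apply: (measurableT_comp mh); exact: measurable_fun_pair.
have mI d (T : measurableType d) (y1 y2 : T -> R) (r : R): measurable_fun setT y1 ->
    measurable_fun setT y2 ->
    measurable_fun setT (fun x => \int[gauss r]_w h (y1 x, y2 x + w)%R)%E.
  move=> m1 m2.
  apply: (@measurable_fun_fubini_tonelli_F _ _ _ _ _ (gauss r)
    (fun z : T * R => h (y1 z.1, y2 z.1 + z.2)%R)) => //.
  apply: mpair; first exact: (measurableT_comp m1 measurable_fst).
  apply: measurable_funD => //; exact: (measurableT_comp m2 measurable_fst).
transitivity (\int[gauss e]_b1 \int[gauss e]_b2 \int[gauss s]_w1 \int[gauss s]_w2
   h (b1 + w1, b2 + w2)%R)%E.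
  have mK : measurable_fun setT (fun x => \int[gauss2 s]_y (h \o chan_out) (x, y))%E.
    by apply: (@measurable_fun_fubini_tonelli_F _ _ _ _ _ (gauss2 s) (h \o chan_out));
      first [exact: mho|move=> p; exact: h0].
  have K0 x : (0 <= \int[gauss2 s]_y (h \o chan_out) (x, y))%E.
    by apply: integral_ge0 => y _; exact: h0.
  rewrite (ge0_integral_gauss2 e mK K0).
  apply: eq_integral => b1 _; apply: eq_integral => b2 _.
  have mL : measurable_fun setT (fun y : R * R => h (b1 + y.1, b2 + y.2)%R).
    by apply: mpair; apply: measurable_funD => //.
  exact: (ge0_integral_gauss2 s mL (fun y => h0 _)).
transitivity (\int[gauss e]_b1 \int[gauss s]_w1 \int[gauss t]_y2 h (b1 + w1, y2)%R)%E.
  apply: eq_integral => b1 _.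
  pose k (z : R * R) : \bar R := (\int[gauss s]_w2 h (b1 + z.2, z.1 + w2)%R)%E.
  have mk : measurable_fun setT k.
    exact: (mI _ _ _ _ _ (measurable_funD (measurable_cst b1) measurable_snd) measurable_fst).
  have k0 z : (0 <= k z)%E by apply: integral_ge0 => w _; exact: h0.
  (* The exchange of [b2] and [w1] that puts the imaginary input beside the imaginary noise. *)
  transitivity (\int[gauss s]_w1 \int[gauss e]_b2 k (b2, w1))%E.
    by apply: (@fubini_tonelli _ _ _ _ _ (gauss e) (gauss s) k); first [exact: mk|exact: k0].
  apply: eq_integral => w1 _; rewrite /k/=.
  by rewrite (gauss_conv e s 
    (mpair _ _ (cst (b1 + w1)) id (measurable_cst _) (@measurable_id _ _ _))
    (fun x => h0 _)).
rewrite (ge0_integral_gauss2 t mh h0).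
have mF : measurable_fun setT (fun y1 : R => \int[gauss t]_y2 h (y1, y2))%E.
  exact: (@measurable_fun_fubini_tonelli_F _ _ _ _ _ (gauss t) h).
by rewrite (gauss_conv e s mF (fun x => integral_ge0 _ _)).
Qed.

Lemma channel_out_law A : measurable A ->
  channel_law (chan_out @^-1` A) = gauss2 t A.
Proof.
move=> mA.
have m1 : measurable_fun setT (fun p => (\1_A p : R)%:E).
  by apply/measurable_EFinP; exact: measurable_indic.
have ind0 p : (0 <= (\1_A p : R)%:E)%E by rewrite lee_fin.
rewrite -(integral_indic_comp channel_law measurable_chan_out mA).
rewrite (integral_channel_out m1 (fun y => ind0 y)).
exact: (integral_indic_comp (gauss2 t) (@measurable_id _ _ _) mA).
Qed.

Lemma channel_in_law B : measurable B ->
  channel_law (fst @^-1` B) = gauss2 e B.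
Proof.
move=> mB; rewrite (_ : fst @^-1` B = B `*` setT).
  rewrite channel_setM//.
  by rewrite [X in (_ * X)%E](_ : _ = 1%E) ?mule1//; exact: probability_setT.
by apply/seteqP; split => x //= [].
Qed.

(** The hypothesis [tilt] for the complex channel: for a fixed input, [integral_tilt] is used once
    per component, and the output decouples from the input. *)
Lemma channel_tilt A B : measurable A -> measurable B ->
  (\int[channel_law]_(p in chan_out @^-1` A `&` fst @^-1` B) (expR (- chan_llr p))%:E =
   channel_law (chan_out @^-1` A) * channel_law (fst @^-1` B))%E.
Proof.
move=> mA mB.
rewrite channel_out_law// channel_in_law// integral_mkcond.
pose E (y : R) (w : R) : \bar R := (expR (- llr y w))%:E.
have E0 y w : (0 <= E y w)%E by rewrite lee_fin expR_ge0.
(* The factors are ordered for integration over the imaginary noise first, the weight of the real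
   noise being constant there. *)
pose F (p : (R * R) * (R * R)) : \bar R := ((\1_B p.1 : R)%:E *
  ((\1_A (chan_out p) : R)%:E * E (p.1.2 + p.2.2)%R p.2.2 * E (p.1.1 + p.2.1)%R p.2.1))%E.
have ind0 (D : set (R * R)) p : (0 <= (\1_D p : R)%:E)%E by rewrite lee_fin.
have mind (D : set (R * R)) : measurable D -> measurable_fun setT (fun p => (\1_D p : R)%:E).
  by move=> mD; apply/measurable_EFinP; exact: measurable_indic.
have F0 p : (0 <= F p)%E by rewrite /F !mule_ge0.
have mE d (T : measurableType d) (Y W : T -> R) :
    measurable_fun setT Y -> measurable_fun setT W ->
    measurable_fun setT (fun x => E (Y x) (W x)) by exact: measurable_expllr.
have mF : measurable_fun setT F.
  apply: emeasurable_funM; first exact: (measurableT_comp (mind _ mB) measurable_fst).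
  apply: emeasurable_funM; first apply: emeasurable_funM.
  - exact: (measurableT_comp (mind _ mA) measurable_chan_out).
  - apply: mE; last exact: (measurableT_comp measurable_snd measurable_snd).
    exact: (measurableT_comp measurable_snd measurable_chan_out).
  - apply: mE; last exact: (measurableT_comp measurable_fst measurable_snd).
    exact: (measurableT_comp measurable_fst measurable_chan_out).
transitivity (\int[channel_law]_p F p)%E.
  apply: eq_integral => p _; rewrite /F /patch /chan_llr /E.
  rewrite -!EFinM -mulrA -expRD opprD [X in expR X]addrC !indicE in_setI.
  rewrite (_ : (p \in chan_out @^-1` A) = (chan_out p \in A)); last first.
    by apply/idP/idP; rewrite !inE.
  rewrite (_ : (p \in fst @^-1` B) = (p.1 \in B)); last first.
    by apply/idP/idP; rewrite !inE.
  by case: (_ \in A); case: (_ \in B); rewrite /= ?mul1r ?mul0r ?mulr0 ?mul1r.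
rewrite (ge0_integral_channel mF F0).
transitivity (\int[gauss2 e]_b (gauss2 t A * (\1_B b : R)%:E))%E.
  apply: eq_integral => b _; rewrite /F /chan_out/=.
  have mshift (c : R) d (T : measurableType d) (W : T -> R) : measurable_fun setT W ->
      measurable_fun setT (fun x => c + W x) by move=> mW; exact: measurable_funD.
  have mA2 d (T : measurableType d) (y1 y2 : T -> R) : measurable_fun setT y1 ->
      measurable_fun setT y2 -> measurable_fun setT (fun x => (\1_A (y1 x, y2 x) : R)%:E).
    by move=> m1 m2; apply: (measurableT_comp (mind _ mA)); exact: measurable_fun_pair.
  have mG d (T : measurableType d) (w1 w2 : T -> R) : measurable_fun setT w1 ->
      measurable_fun setT w2 ->
      measurable_fun setT (fun x =>
        (\1_A (b.1 + w1 x, b.2 + w2 x)%R : R)%:E * E (b.2 + w2 x)%R (w2 x))%E.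
    move=> m1 m2; apply: emeasurable_funM; first by apply: mA2; exact: mshift.
    by apply: mE => //; exact: mshift.
  rewrite ge0_integralZl//; last 2 first.
  - apply: emeasurable_funM; first by apply: mG.
    by apply: mE => //; exact: mshift.
  - by move=> w _; rewrite !mule_ge0.
  rewrite muleC; congr (_ * _)%E.
  rewrite ge0_integral_gauss2//; last 2 first.
  - apply: emeasurable_funM; first by apply: mG.
    by apply: mE => //; exact: mshift.
  - by move=> w; rewrite !mule_ge0.
  rewrite /=.
  transitivity (\int[gauss s]_w1 ((\int[gauss t]_y2 (\1_A (b.1 + w1, y2)%R : R)%:E) *
      E (b.1 + w1)%R w1))%E.
    apply: eq_integral => w1 _.
    have mg := mG _ _ (cst w1) id (measurable_cst _) (@measurable_id _ _ _).
    rewrite (ge0_integralZr _ measurableT mg (fun w _ => mule_ge0 (ind0 _ _) (E0 _ _)) (E0 _ _)).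
    congr (_ * _)%E.
    exact: (@integral_tilt (fun y => (\1_A (b.1 + w1, y)%R : R)%:E) b.2
      (mA2 _ _ (cst _) id (measurable_cst _) (@measurable_id _ _ _)) (fun=> ind0 _ _)).
  have mI : measurable_fun setT (fun y : R => \int[gauss t]_y2 (\1_A (y, y2)%R : R)%:E)%E.
    by apply: (@measurable_fun_fubini_tonelli_F _ _ _ _ _ (gauss t) (fun z => (\1_A z)%:E));
      first [exact: mind|move=> z; exact: ind0].
  rewrite (@integral_tilt _ b.1 mI); last by move=> y; exact: integral_ge0.
  rewrite -(@ge0_integral_gauss2 t (fun z => (\1_A z)%:E) (mind _ mA) (ind0 A)).
  exact: (integral_indic_comp (gauss2 t) (@measurable_id _ _ _) mA).
rewrite (ge0_integralZl _ measurableT (mind _ mB) (fun x _ => ind0 B x) (measure_ge0 _ _)).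
congr (_ * _)%E.
exact: (integral_indic_comp (gauss2 e) (@measurable_id _ _ _) mB).
Qed.


Lemma ge0_integrable_Rintegral d (T : measurableType d) (m : probability T R)
    (h : T -> R) (c : R) : measurable_fun setT h -> (forall x, 0 <= h x) ->
  (\int[m]_x (h x)%:E = c%:E)%E ->
  m.-integrable setT (EFin \o h) /\ \int[m]_x h x = c.
Proof.
move=> mh h0 hc; split; last by rewrite /Rintegral hc.
apply/integrableP; split; first exact/measurable_EFinP.
by under eq_integral do rewrite /= ger0_norm//; rewrite hc ltry.
Qed.

(** Kept symbolic: in the mean of [chan_llr] the output and noise terms contribute the same multiple
    of [M] with opposite signs. *)
Let M : R := fine (\int[gauss (1 : R)]_x (x ^+ 2)%:E)%E.
Let gauss_sqrM r : (\int[gauss r]_x (x ^+ 2)%:E = (r ^+ 2 * M)%:E)%E.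
Proof.
rewrite integral_gauss_sqr [RHS]EFinM /M fineK//.
rewrite ge0_fin_numE; first exact: gauss_sqr_lty.
by apply: integral_ge0 => x _; rewrite lee_fin sqr_ge0.
Qed.

Let mcst_integral (r : R) (x : \bar R) : (0 <= x)%E -> (\int[gauss r]__ x = x)%E.
Proof.
move=> x0; rewrite integral_cst// [X in (_ * X)%E](_ : _ = 1%E) ?mule1//.
exact: probability_setT.
Qed.

Let msqr1 : measurable_fun setT (fun y : R * R => (y.1 ^+ 2)%:E).
Proof. by apply/measurable_EFinP; exact: measurable_funX. Qed.
Let msqr2 : measurable_fun setT (fun y : R * R => (y.2 ^+ 2)%:E).
Proof. by apply/measurable_EFinP; exact: measurable_funX. Qed.
Let sqr10 (y : R * R) : (0 <= (y.1 ^+ 2)%:E)%E. Proof. by rewrite lee_fin sqr_ge0. Qed.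
Let sqr20 (y : R * R) : (0 <= (y.2 ^+ 2)%:E)%E. Proof. by rewrite lee_fin sqr_ge0. Qed.

Let gauss2_sqr1 r : (\int[gauss2 r]_y (y.1 ^+ 2)%:E = (r ^+ 2 * M)%:E)%E.
Proof.
rewrite (ge0_integral_gauss2 r msqr1 sqr10)/= -gauss_sqrM.
by apply: eq_integral => x _; rewrite mcst_integral// lee_fin sqr_ge0.
Qed.

Let gauss2_sqr2 r : (\int[gauss2 r]_y (y.2 ^+ 2)%:E = (r ^+ 2 * M)%:E)%E.
Proof.
rewrite (ge0_integral_gauss2 r msqr2 sqr20)/= gauss_sqrM mcst_integral//.
rewrite lee_fin mulr_ge0 ?sqr_ge0// fine_ge0//.
by apply: integral_ge0 => x _; rewrite lee_fin sqr_ge0.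
Qed.

Let channel_noise_integral (h : R * R -> \bar R) (c : R) : measurable_fun setT h ->
  (forall x, 0 <= h x)%E -> 0 <= c -> (\int[gauss2 s]_y h y = c%:E)%E ->
  (\int[channel_law]_p h p.2 = c%:E)%E.
Proof.
move=> mh h0 c0 hc.
rewrite (ge0_integral_channel (measurableT_comp mh measurable_snd) (fun p => h0 _))/=.
rewrite (eq_integral (cst c%:E)); last by move=> x _; rewrite hc.
rewrite integral_cst// [X in (_ * X)%E](_ : _ = 1%E) ?mule1//.
exact: probability_setT.
Qed.

(** The quadratic terms cancel in the mean, and each of the two components leaves [ln (t / s)]; the
    sum is the logarithm of [t ^+ 2 / s ^+ 2], without a factor 1/2. *)
Lemma integral_chan_llr :
  channel_law.-integrable setT (EFin \o chan_llr) /\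
  \int[channel_law]_p chan_llr p = ln (1 + e ^+ 2 / s ^+ 2).
Proof.
have M0 : 0 <= M.
  by rewrite fine_ge0//; apply: integral_ge0 => x _; rewrite lee_fin sqr_ge0.
have [i1 I1] : channel_law.-integrable setT (EFin \o (fun p => (chan_out p).1 ^+ 2)) /\
    \int[channel_law]_p ((chan_out p).1 ^+ 2) = t ^+ 2 * M.
  apply: ge0_integrable_Rintegral; last by rewrite (integral_channel_out msqr1 sqr10).
  - apply: measurable_funX; exact: (measurableT_comp measurable_fst measurable_chan_out).
  - by move=> p; exact: sqr_ge0.
have [i2 I2] : channel_law.-integrable setT (EFin \o (fun p => (chan_out p).2 ^+ 2)) /\
    \int[channel_law]_p ((chan_out p).2 ^+ 2) = t ^+ 2 * M.
  apply: ge0_integrable_Rintegral; last by rewrite (integral_channel_out msqr2 sqr20).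
  - apply: measurable_funX; exact: (measurableT_comp measurable_snd measurable_chan_out).
  - by move=> p; exact: sqr_ge0.
have [i3 I3] : channel_law.-integrable setT (EFin \o (fun p => p.2.1 ^+ 2)) /\
    \int[channel_law]_p (p.2.1 ^+ 2) = s ^+ 2 * M.
  apply: ge0_integrable_Rintegral; last first.
    by apply: (channel_noise_integral msqr1 sqr10) => //; rewrite mulr_ge0 ?sqr_ge0.
  - by move=> p; exact: sqr_ge0.
  - apply: measurable_funX; exact: (measurableT_comp measurable_fst measurable_snd).
have [i4 I4] : channel_law.-integrable setT (EFin \o (fun p => p.2.2 ^+ 2)) /\
    \int[channel_law]_p (p.2.2 ^+ 2) = s ^+ 2 * M.
  apply: ge0_integrable_Rintegral; last first.
    by apply: (channel_noise_integral msqr2 sqr20) => //; rewrite mulr_ge0 ?sqr_ge0.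
  - by move=> p; exact: sqr_ge0.
  - apply: measurable_funX; exact: (measurableT_comp measurable_snd measurable_snd).
have iZ (h : (R * R) * (R * R) -> R) (r : R) : channel_law.-integrable setT (EFin \o h) ->
    channel_law.-integrable setT (EFin \o (fun p => r * h p)).
  move=> ih; apply: (eq_integrable measurableT (fun p => r%:E * (h p)%:E)%E) => //.
  exact: integrableZl.
have iD (h1 h2 : (R * R) * (R * R) -> R) : channel_law.-integrable setT (EFin \o h1) ->
    channel_law.-integrable setT (EFin \o h2) ->
    channel_law.-integrable setT (EFin \o (fun p => h1 p + h2 p)).
  move=> ih1 ih2; apply: (eq_integrable measurableT (fun p => (h1 p)%:E + (h2 p)%:E)%E) => //.
  exact: integrableD.
have icst (r : R) : channel_law.-integrable setT (EFin \o cst r).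
  exact: finite_measure_integrable_cst.
pose q1 := (2 * t ^+ 2)^-1; pose q2 := - (2 * s ^+ 2)^-1.
have E : chan_llr = fun p => cst (ln (t / s) + ln (t / s)) p +
   (q1 * ((chan_out p).1 ^+ 2 + (chan_out p).2 ^+ 2) + q2 * (p.2.1 ^+ 2 + p.2.2 ^+ 2)).
  apply/funext => p; rewrite /chan_llr /llr /chan_out/= /q1 /q2.
  by rewrite !mulrDr !mulNr; ring.
have iE1 := iZ _ q1 (iD _ _ i1 i2); have iE2 := iZ _ q2 (iD _ _ i3 i4).
have iE := iD _ _ iE1 iE2.
split; rewrite E; first exact: (iD _ _ (icst _) iE).
rewrite (RintegralD measurableT (icst _) iE).
rewrite (RintegralD measurableT iE1 iE2).
rewrite (RintegralZl q1 measurableT (iD _ _ i1 i2)) (RintegralZl q2 measurableT (iD _ _ i3 i4)).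
rewrite (RintegralD measurableT i1 i2) (RintegralD measurableT i3 i4) I1 I2 I3 I4.
rewrite Rintegral_cst// [X in fine X](_ : _ = 1%E); last exact: probability_setT.
rewrite mulr1 /q1 /q2.
have ts : 1 + e ^+ 2 / s ^+ 2 = (t / s) ^+ 2.
  by rewrite expr_div_n t2; field; rewrite gt_eqF.
have -> : ln (1 + e ^+ 2 / s ^+ 2) = ln (t / s) + ln (t / s).
  by rewrite ts expr2 lnM ?posrE ?divr_gt0.
have cancel (x y : R) : 0 < x -> (2 * x)^-1 * (x * y + x * y) = y.
  by move=> x0; field; rewrite gt_eqF.
rewrite mulNr !cancel ?exprn_gt0//.
by rewrite addrN addr0.
Qed.

End channel.

(** * Quantisation of the line and the plane *)

Section quantizer.
Context {R : realType} (c n : nat).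
Hypothesis c0 : (0 < c)%N.

(** The box has half-width [n.+1]. The ratio is quadratic, so its variation over a cell is of the
    order of the half-width times the step; a step of order [n.+1 ^ 2] in the denominator leaves an
    error of order [1 / n.+1]. *)
Definition qcells : nat := (2 * c * n.+1 ^ 3)%N.
Definition qstep : R := (c * n.+1 ^ 2)%:R^-1.
Definition qrep (i : nat) : R := i%:R * qstep - n.+1%:R.
(** The last index collects all points outside the box; the other cells are half-open with left
    endpoint [qrep i]. *)
Definition quant (x : R) : 'I_qcells.+1 :=
  if (- n.+1%:R <= x) && (x < n.+1%:R)
  then inord (Num.truncn ((x + n.+1%:R) / qstep)) else ord_max.

Lemma qstep_gt0 : 0 < qstep.
Proof. by rewrite invr_gt0 ltr0n muln_gt0 c0 expn_gt0. Qed.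

Lemma qcells_step : qcells%:R * qstep = n.+1%:R + n.+1%:R.
Proof.
rewrite /qcells /qstep !expnS expn0 muln1 !natrM; field.
by rewrite nat1r !pnatr_eq0/= -lt0n.
Qed.

Lemma quant_eq (i : 'I_qcells.+1) x : (i < qcells)%N ->
  (quant x == i) = (qrep i <= x) && (x < qrep i + qstep).
Proof.
move=> im; have d0 := qstep_gt0.
have i1 : i.+1%:R * qstep <= n.+1%:R + n.+1%:R.
  by rewrite -qcells_step ler_pM2r// ler_nat.
have iE : qrep i + qstep = i.+1%:R * qstep - n.+1%:R.
  by rewrite /qrep -natr1; ring.
have i0 : 0 <= i%:R * qstep by rewrite mulr_ge0// ltW.
apply/eqP/andP => [|[x1 x2]].
  rewrite /quant; case: ifPn => [/andP[x1 x2] E|_ E]; last first.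
    by move: im; rewrite -E ltnn.
  have q0 : 0 <= (x + n.+1%:R) / qstep.
    by rewrite divr_ge0 ?(ltW d0)// -lerBlDr sub0r.
  have /andP[t1 t2] := truncn_itv q0.
  have tm : (Num.truncn ((x + n.+1%:R) / qstep) < qcells.+1)%N.
    rewrite ltnS -(ler_nat R) (le_trans t1)// ler_pdivrMr// qcells_step.
    by rewrite lerD2r ltW.
  move: t1 t2; rewrite -(inordK tm) E ler_pdivlMr// ltr_pdivrMr// iE.
  by rewrite lerBlDr ltrBrDr.
have x3 : - n.+1%:R <= x by apply: le_trans x1; rewrite lerBrDr addNr.
have x4 : x < n.+1%:R.
  by apply: (lt_le_trans x2); rewrite iE lerBlDr.
rewrite /quant x3 x4/=; apply/val_inj/eqP; rewrite /= (_ : Num.truncn _ = i).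
  by rewrite inordK.
apply: truncn_def; rewrite ler_pdivlMr// ltr_pdivrMr//.
by rewrite -lerBlDr -/(qrep i) x1/= -ltrBrDr -iE.
Qed.

Lemma quant_lt x : (quant x < qcells)%N = (- n.+1%:R <= x) && (x < n.+1%:R).
Proof.
have d0 := qstep_gt0.
rewrite /quant; case: ifPn => [/andP[x1 x2]|_]; last by rewrite ltnn.
have q0 : 0 <= (x + n.+1%:R) / qstep.
  by rewrite divr_ge0 ?(ltW d0)// -lerBlDr sub0r.
have /andP[t1 t2] := truncn_itv q0.
have tm : (Num.truncn ((x + n.+1%:R) / qstep) < qcells)%N.
  rewrite -(ltr_nat R) (le_lt_trans t1)// ltr_pdivrMr// qcells_step.
  by rewrite ltrD2r.
by rewrite inordK// ltnS ltnW.
Qed.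

Lemma quant_close x : (quant x < qcells)%N ->
  `|x - qrep (quant x)| <= qstep /\ `|qrep (quant x)| <= n.+1%:R.
Proof.
move=> q; have := quant_eq x q; rewrite eqxx => /esym/andP[x1 x2].
move: q; rewrite quant_lt => /andP[x3 x4].
split.
  by rewrite ger0_norm ?subr_ge0// lerBlDl ltW.
rewrite ler_norml (ltW (le_lt_trans x1 x4)) andbT /qrep lerBrDr addNr.
by rewrite mulr_ge0// ltW// qstep_gt0.
Qed.

Lemma measurable_quant i : measurable (quant @^-1` [set i]).
Proof.
have [im|im] := ltnP i qcells.
  rewrite (_ : _ @^-1` _ = `[qrep i, (qrep i + qstep)[%classic)//.
  apply/seteqP; split => x /=; rewrite in_itv/= -quant_eq// => /eqP//.
have -> : i = ord_max by apply/val_inj/eqP; rewrite /= eqn_leq im -ltnS ltn_ord.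
rewrite (_ : _ @^-1` _ = ~` `[- n.+1%:R, n.+1%:R[%classic).
  exact: measurableC.
apply/seteqP; split => x /=; rewrite in_itv/= -quant_lt.
  by move=> ->; rewrite ltnn.
by move=> /negP; rewrite -leqNgt => H; apply/val_inj/eqP; rewrite /= eqn_leq H -ltnS ltn_ord.
Qed.

Definition quant2 (x : R * R) := (quant x.1, quant x.2).

Lemma measurable_quant2 ij : measurable (quant2 @^-1` [set ij]).
Proof.
case: ij => i j.
rewrite (_ : _ @^-1` _ = (quant @^-1` [set i]) `*` (quant @^-1` [set j])).
  by apply: measurableX; exact: measurable_quant.
by rewrite /quant2; apply/seteqP; split => -[x y] /= [-> ->].
Qed.

End quantizer.

(** * Mutual information of the complex Gaussian channel *)

Section channel_mi.
Context {R : realType} (e s : R).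
Hypotheses (e0 : 0 < e) (s0 : 0 < s).
Let t := Num.sqrt (e ^+ 2 + s ^+ 2).
Let t_gt0 : 0 < t.
Proof. by rewrite sqrtr_gt0 addr_gt0// exprn_gt0. Qed.

(** The Lipschitz constant per unit of box size. Perturbing by [D], the square of [y] moves by at
    most [2 N D] and that of [y - b] by at most [8 N D]; these are divided by [2 t ^+ 2] and
    [2 s ^+ 2]. *)
Let A : R := (t ^+ 2)^-1 + 4 / s ^+ 2.

Lemma llr_lipschitz (N D y b y' b' : R) : 
  `|y| <= N -> `|b| <= N -> `|y'| <= N -> `|b'| <= N ->
  `|y - y'| <= D -> `|b - b'| <= D ->
  `|llr e s y' (y' - b') - llr e s y (y - b)| <= N * D * A.
Proof.
move=> yN bN y'N b'N yD bD.
have N0 : 0 <= N by apply: le_trans yN.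
have D0 : 0 <= D by apply: le_trans yD.
have E1 : `|y' ^+ 2 - y ^+ 2| <= D * (2 * N).
  rewrite subr_sqr normrM ler_pM// 1?distrC// (le_trans (ler_normD _ _))//; lra.
have E2 : `|(y' - b') ^+ 2 - (y - b) ^+ 2| <= (2 * D) * (4 * N).
  rewrite subr_sqr normrM ler_pM//.
    rewrite (_ : _ - _ = (y' - y) - (b' - b)); last by ring.
    rewrite (le_trans (ler_normB _ _))// 1?distrC [`|b' - b|]distrC.
    by rewrite mulr_natl mulr2n lerD.
  rewrite (le_trans (ler_normD _ _))//.
  have := ler_normB y' b'; have := ler_normB y b; lra.
rewrite (_ : llr e s y' (y' - b') - llr e s y (y - b) =
  (y' ^+ 2 - y ^+ 2) / (2 * t ^+ 2) - ((y' - b') ^+ 2 - (y - b) ^+ 2) / (2 * s ^+ 2)); last first.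
  by rewrite /llr -/t; ring.
have T0 : 0 < 2 * t ^+ 2 by rewrite mulr_gt0// exprn_gt0.
have S0 : 0 < 2 * s ^+ 2 by rewrite mulr_gt0// exprn_gt0.
apply: (le_trans (ler_normB _ _)); rewrite !normrM !normfV (gtr0_norm T0) (gtr0_norm S0).
rewrite (_ : N * D * A = D * (2 * N) / (2 * t ^+ 2) + 2 * D * (4 * N) / (2 * s ^+ 2)).
  by apply: lerD; rewrite ler_pM2r ?invr_gt0.
by rewrite /A; field; rewrite !gt_eqF.
Qed.

(** The factor 2 accounts for the two components; with this [c] the quantisation error inside the
    box is at most [1 / n.+1]. *)
Let c := (Num.truncn (2 * A)).+1.
Let c0 : (0 < c)%N. Proof. by []. Qed.
Let A0 : 0 <= A.
Proof. by rewrite addr_ge0// ?divr_ge0 ?invr_ge0 ?exprn_ge0// ltW. Qed.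
Let cA : 2 * A <= c%:R.
Proof.
have A2 : 0 <= 2 * A by rewrite mulr_ge0.
by have /andP[_ /ltW] := truncn_itv A2.
Qed.

(** The test function of [mutual_info_ge]: the ratio at the cell representatives. The value 0
    outside the box satisfies both domination hypotheses of [mutual_infoE]. *)
Definition cell_llr n (k l : 'I_(qcells c n).+1 * 'I_(qcells c n).+1) : R :=
  if [&& (k.1 < qcells c n)%N, (k.2 < qcells c n)%N, (l.1 < qcells c n)%N & (l.2 < qcells c n)%N]
  then llr e s (qrep c n k.1) (qrep c n k.1 - qrep c n l.1) +
       llr e s (qrep c n k.2) (qrep c n k.2 - qrep c n l.2)
  else 0.

Let cw n (p : (R * R) * (R * R)) := cell_llr (quant2 c n (chan_out p)) (quant2 c n p.1).

Let in_box n (p : (R * R) * (R * R)) :=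
  [&& (quant c n (chan_out p).1 < qcells c n)%N, (quant c n (chan_out p).2 < qcells c n)%N,
      (quant c n p.1.1 < qcells c n)%N & (quant c n p.1.2 < qcells c n)%N].

Let cw_close n p : in_box n p -> `|cw n p - chan_llr e s p| <= n.+1%:R^-1.
Proof.
move=> H; rewrite /cw /cell_llr/= -/(in_box n p) H.
case/and4P: H => y1 y2 b1 b2.
have [y1c y1r] := quant_close c0 y1; have [y2c y2r] := quant_close c0 y2.
have [b1c b1r] := quant_close c0 b1; have [b2c b2r] := quant_close c0 b2.
have nrm x : (quant c n x < qcells c n)%N -> `|x| <= (n.+1%:R : R).
  by rewrite (quant_lt n c0) ler_norml => /andP[-> /ltW].
rewrite (_ : chan_llr e s p = llr e s (chan_out p).1 ((chan_out p).1 - p.1.1) +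
  llr e s (chan_out p).2 ((chan_out p).2 - p.1.2)); last first.
  by rewrite /chan_llr /chan_out/=; congr (llr _ _ _ _ + llr _ _ _ _); ring.
have L1 := llr_lipschitz (nrm _ y1) (nrm _ b1) y1r b1r y1c b1c.
have L2 := llr_lipschitz (nrm _ y2) (nrm _ b2) y2r b2r y2c b2c.
rewrite /chan_out/= in L1 L2 *.
move: L1 L2.
move: (llr e s (qrep c n (quant c n (p.1.1 + p.2.1))) _)
  (llr e s (qrep c n (quant c n (p.1.2 + p.2.2))) _)
  (llr e s (p.1.1 + p.2.1) _) (llr e s (p.1.2 + p.2.2) _) => u1 u2 v1 v2 L1 L2.
rewrite (_ : u1 + u2 - (v1 + v2) = (u1 - v1) + (u2 - v2)); last by ring.
apply: (le_trans (ler_normD _ _)); apply: (le_trans (lerD L1 L2)).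
rewrite -mulrDr [A + A](_ : _ = 2 * A); last by rewrite mulr_natl mulr2n.
apply: (@le_trans _ _ (n.+1%:R * qstep c n * c%:R)).
  by apply: ler_wpM2l => //; rewrite mulr_ge0// ltW// qstep_gt0.
rewrite /qstep !expnS expn0 muln1 !natrM le_eqVlt; apply/orP; left; apply/eqP; field.
by rewrite nat1r !pnatr_eq0.
Qed.

Let cw_out n p : ~~ in_box n p -> cw n p = 0.
Proof. by move=> H; rewrite /cw /cell_llr/= -/(in_box n p) (negbTE H). Qed.

Lemma mutual_info_channel :
  mutual_info (channel_law e s) chan_out fst = (log2 (1 + e ^+ 2 / s ^+ 2))%:E.
Proof.
have [il Il] := integral_chan_llr e0 s0.
rewrite /log2 -Il.
apply: (@mutual_infoE _ _ _ _ _ _ _ (channel_law e s) chan_out fst (chan_llr e s)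
  measurable_chan_out measurable_fst il (channel_tilt e0 s0) _ _
  (fun n => quant2 c n) (fun n => quant2 c n) cell_llr).
- by move=> n i; exact: measurable_quant2.
- by move=> n i; exact: measurable_quant2.
- move=> p; apply/cvgrPdist_le => /= eps eps0.
  (* One [N] serves twice: beyond it the point lies in the box and the error is below [eps]. *)
  have [N HN] : exists N : nat, `|(chan_out p).1| + `|(chan_out p).2| + `|p.1.1| + `|p.1.2| + eps^-1 < N%:R.
    exists (Num.truncn (`|(chan_out p).1| + `|(chan_out p).2| + `|p.1.1| + `|p.1.2| + eps^-1)).+1.
    have H0 : 0 <= `|(chan_out p).1| + `|(chan_out p).2| + `|p.1.1| + `|p.1.2| + eps^-1.
      by rewrite !addr_ge0// invr_ge0 ltW.
    by have /andP[] := truncn_itv H0.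
  exists N => // n /= Nn.
  have Nn' : (N%:R : R) <= n.+1%:R by rewrite ler_nat leqW.
  have ei : 0 < eps^-1 by rewrite invr_gt0.
  have n1 := normr_ge0 (chan_out p).1; have n2 := normr_ge0 (chan_out p).2.
  have n3 := normr_ge0 p.1.1; have n4 := normr_ge0 p.1.2.
  have inb x : `|x| < (n.+1%:R : R) -> (quant c n x < qcells c n)%N.
    by rewrite (quant_lt n c0) ltr_norml => /andP[/ltW -> ->].
  rewrite distrC (le_trans (cw_close _))//.
    by rewrite /in_box !inb//; lra.
  rewrite -[leRHS]invrK lef_pV2 ?posrE ?invr_gt0//; lra.
- move=> n p; have [/cw_close H|/cw_out H] := boolP (in_box n p); last first.
    by rewrite -/(cw n p) H normr0 addr_ge0.
  rewrite -/(cw n p) -[X in `|X|](subrK (chan_llr e s p)) addrC (le_trans (ler_normD _ _))// lerD2l.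
  by rewrite (le_trans H)// invf_le1// ler1n.
- move=> n p; have [/cw_close H|/cw_out H] := boolP (in_box n p); last first.
    by rewrite -/(cw n p) H le_max lexx.
  rewrite -/(cw n p) le_max; apply/orP; right.
  by rewrite -lerBlDl (le_trans (ler_norm _))// (le_trans H)// invf_le1// ler1n.
Qed.

End channel_mi.

(** * The matched filter given the spreading matrix *)

Section conditional.
Context {R : realType}.

(** Marginals are rectangles with one side [setT], so rectangle probabilities determine everything.
    This carries the computation from [cond_prob] over to [channel_law]. *)
Lemma mutual_info_congr d d' dX dY (T : measurableType d) (T' : measurableType d')
    (X : measurableType dX) (Y : measurableType dY)
    (mu : set T -> \bar R) (mu' : set T' -> \bar R) (f : T -> X) (g : T -> Y)
    (f' : T' -> X) (g' : T' -> Y) :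
  (forall A B, measurable A -> measurable B ->
    mu (f @^-1` A `&` g @^-1` B) = mu' (f' @^-1` A `&` g' @^-1` B)) ->
  mutual_info mu f g = mutual_info mu' f' g'.
Proof.
move=> H; congr ereal_sup; apply/seteqP.
have Hf A : measurable A -> mu (f @^-1` A) = mu' (f' @^-1` A).
  move=> mA; have := H A setT mA measurableT.
  by rewrite !preimage_setT !setIT.
have Hg B : measurable B -> mu (g @^-1` B) = mu' (g' @^-1` B).
  move=> mB; have := H setT B measurableT mB.
  by rewrite !preimage_setT !setTI.
split => v [n [m [A [B [pA [pB ->]]]]]]; exists n, m, A, B; split => //; split => //;
  congr (_%:E); apply: eq_bigr => i _; apply: eq_bigr => j _;
  by rewrite H ?Hf ?Hg//; move: pA pB => [? _] [? _].
Qed.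

Lemma gauss_scale (c r : R) B : gauss r ((fun x => c * x) @^-1` B) = gauss (c * r) B.
Proof.
by rewrite /gauss /pushforward; congr (normal_prob 0 1 _); apply/seteqP; split => x /=; rewrite mulrA.
Qed.

Context d (T : measurableType d) (P : probability T R) (N K : nat)
  (S : T -> 'M[R]_(N, K.+1)) (b : T -> 'I_K.+1 -> R * R) (z : T -> 'I_N -> R * R)
  (M : 'M[R]_(N, K.+1)) (p e v : R).
Hypotheses (p0 : 0 < p) (e0 : 0 < e) (v0 : 0 < v).
Hypothesis mS : measurable [set w | S w = M].
Hypothesis mb : forall k, measurable_fun setT (fun w => (b w k).1) /\
               measurable_fun setT (fun w => (b w k).2).
Hypothesis mz : forall i, measurable_fun setT (fun w => (z w i).1) /\
               measurable_fun setT (fun w => (z w i).2).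
Hypothesis law : forall (Br Bi : 'I_K.+1 -> set R) (Zr Zi : 'I_N -> set R),
     (forall k, measurable (Br k) /\ measurable (Bi k)) ->
     (forall i, measurable (Zr i) /\ measurable (Zi i)) ->
     P [set w | S w = M /\
                  (forall k, Br k (b w k).1 /\ Bi k (b w k).2) /\
                  (forall i, Zr i (z w i).1 /\ Zi i (z w i).2)]
     = (p * (\prod_(k < K.+1) (fine (normal_prob 0 e (Br k)) * fine (normal_prob 0 e (Bi k))))
        * (\prod_(i < N) (fine (normal_prob 0 v (Zr i)) * fine (normal_prob 0 v (Zi i)))))%:E.

Definition corr (k : 'I_K.+1) : R := \sum_i M i ord0 * M i k.
Hypothesis unit1 : corr ord0 = 1.

(** All disturbances of user 1: the symbols of the other users, weighted by their correlations, and
    the noise entries, weighted by the sequence of user 1. *)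
Let I : finType := ('I_K + 'I_N)%type.
Let coef (i : I) : R := match i with inl k => corr (lift ord0 k) | inr i => M i ord0 end.
Let sd (i : I) : R := match i with inl _ => e | inr _ => v end.
Let src (i : I) (w : T) : R * R := match i with inl k => b w (lift ord0 k) | inr i => z w i end.
Let Yr i w := coef i * (src i w).1.
Let Yi i w := coef i * (src i w).2.

Let mYr i : measurable_fun setT (Yr i).
Proof.
apply: measurable_funM => //; case: i => [k|i]; first exact: (mb _).1.
exact: (mz _).1.
Qed.
Let mYi i : measurable_fun setT (Yi i).
Proof.
apply: measurable_funM => //; case: i => [k|i]; first exact: (mb _).2.
exact: (mz _).2.
Qed.
Let mb1 : measurable_fun setT (fun w => (b w ord0).1). Proof. exact: (mb _).1. Qed.
Let mb2 : measurable_fun setT (fun w => (b w ord0).2). Proof. exact: (mb _).2. Qed.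

Let g r (A : set R) : R := fine (gauss r A).

Let mscale c (B : set R) : measurable B -> measurable ((fun x => c * x) @^-1` B).
Proof. by move=> mB; rewrite -[X in measurable X]setTI; apply: measurable_funM. Qed.

Let law1 (A1 A2 : set R) (Br Bi : I -> set R) : measurable A1 -> measurable A2 ->
  (forall i, measurable (Br i)) -> (forall i, measurable (Bi i)) ->
  P [set w | (S w = M /\ A1 (b w ord0).1 /\ A2 (b w ord0).2 /\
              (forall i, Bi i (Yi i w))) /\ (forall i, Br i (Yr i w))] =
  (p * g e A1 * g e A2 * (\prod_i g (coef i * sd i) (Bi i)) *
   (\prod_i g (coef i * sd i) (Br i)))%:E.
Proof.
move=> mA1 mA2 mBr mBi.
(* A constraint on a scaled variable is a constraint on the variable itself, by taking preimages
   under the scaling; index 0 keeps the set for the symbol of user 1. *)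
pose ext (A : set R) (B : I -> set R) (k : 'I_K.+1) : set R :=
  if unlift ord0 k is Some j then (fun x => corr (lift ord0 j) * x) @^-1` (B (inl j)) else A.
pose zz (B : I -> set R) (i : 'I_N) : set R := (fun x => M i ord0 * x) @^-1` (B (inr i)).
have ext0 A B : ext A B ord0 = A by rewrite /ext unlift_none.
have extl A B j : ext A B (lift ord0 j) = (fun x => corr (lift ord0 j) * x) @^-1` (B (inl j)).
  by rewrite /ext liftK.
have mext A B k : measurable A -> (forall i, measurable (B i)) -> measurable (ext A B k).
  by move=> mA mB; rewrite /ext; case: unlift => // j; exact: mscale.
have := @law (ext A1 Br) (ext A2 Bi) (zz Br) (zz Bi)
  (fun k => conj (mext _ _ _ mA1 mBr) (mext _ _ _ mA2 mBi))
  (fun i => conj (mscale _ (mBr _)) (mscale _ (mBi _))).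
rewrite [X in P X](_ : _ = [set w | (S w = M /\ A1 (b w ord0).1 /\ A2 (b w ord0).2 /\
              (forall i, Bi i (Yi i w))) /\ (forall i, Br i (Yr i w))]); last first.
  apply/seteqP; split => w /=.
    move=> [Sw [Hb Hz]]; have := Hb ord0; rewrite !ext0 => -[H1 H2].
    split; [split => //; split => //; split => // -[k|i]|move=> [k|i]].
    - by have [_] := Hb (lift ord0 k); rewrite extl.
    - by have [_] := Hz i.
    - by have [+ _] := Hb (lift ord0 k); rewrite extl.
    - by have [+ _] := Hz i.
  move=> [[Sw [H1 [H2 Hi]]] Hr]; split => //; split => [k|i].
    have [j ->|->] := unliftP ord0 k; rewrite ?extl ?ext0//; split.
      exact: (Hr (inl j)).
    exact: (Hi (inl j)).
  by split; [exact: (Hr (inr i))|exact: (Hi (inr i))].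
move=> ->; congr (_%:E).
have gE r A : 0 < r -> measurable A -> fine (normal_prob 0 r A) = g r A.
  by move=> r0 mA; rewrite /g gaussE// gt_eqF.
rewrite big_ord_recl !ext0 !gE//.
rewrite (eq_bigr (fun j : 'I_K => g (coef (inl j) * sd (inl j)) (Br (inl j)) *
    g (coef (inl j) * sd (inl j)) (Bi (inl j)))); last first.
  by move=> j _; rewrite !extl !gE//; [rewrite /g !gauss_scale|exact: mscale|exact: mscale].
rewrite [X in _ * X = _](eq_bigr (fun j : 'I_N => g (coef (inr j) * sd (inr j)) (Br (inr j)) *
    g (coef (inr j) * sd (inr j)) (Bi (inr j)))); last first.
  by move=> j _; rewrite !gE//; [rewrite /g !gauss_scale|exact: mscale|exact: mscale].
by rewrite !big_split/= !big_sumType/=; ring.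
Qed.

Let s := Num.sqrt (\sum_i (coef i * sd i) ^+ 2).
Let Wr w := \sum_i Yr i w.
Let Wi w := \sum_i Yi i w.
Let mWr : measurable_fun setT Wr.
Proof. exact: measurable_sum. Qed.
Let mWi : measurable_fun setT Wi.
Proof. exact: measurable_sum. Qed.

Let mset (h : T -> R) (A : set R) : measurable_fun setT h -> measurable A ->
  measurable [set w | A (h w)].
Proof. by move=> mh mA; rewrite -[X in measurable X]setTI; exact: mh. Qed.

(** The real parts are summed while the imaginary ones stay constrained individually; then the
    imaginary parts are summed with the constraint on [Wr] absorbed in the event. *)
Let law2 (A1 A2 C1 C2 : set R) : measurable A1 -> measurable A2 ->
  measurable C1 -> measurable C2 ->
  P [set w | S w = M /\ A1 (b w ord0).1 /\ A2 (b w ord0).2 /\ C1 (Wr w) /\ C2 (Wi w)] =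
  (p * g e A1 * g e A2 * g s C1 * g s C2)%:E.
Proof.
move=> mA1 mA2 mC1 mC2.
have step B : (forall i, measurable (B i)) ->
    P [set w | ([set w | S w = M] `&` [set w | A1 (b w ord0).1] `&` [set w | A2 (b w ord0).2] `&`
       [set w | forall i, B i (Yi i w)]) w /\ C1 (Wr w)] =
    (p * g e A1 * g e A2 * (\prod_i g (coef i * sd i) (B i)) * g s C1)%:E.
  move=> mB; apply: (@law_sum _ _ _ P I Yr (fun i => coef i * sd i)) => //.
    apply: measurableI; last exact: measurable_forall.
    apply: measurableI; last exact: (mset mb2 mA2).
    by apply: measurableI => //; exact: (mset mb1 mA1).
  move=> B' mB'; rewrite -law1//; congr (P _).
  by apply/seteqP; split => w /=; tauto.
have := @law_sum _ _ _ P I Yi (fun i => coef i * sd i) (p * g e A1 * g e A2 * g s C1)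
  ([set w | S w = M] `&` [set w | A1 (b w ord0).1] `&` [set w | A2 (b w ord0).2] `&`
       [set w | C1 (Wr w)]) _ mYi _ C2 mC2.
rewrite -/s -/(g s C2) => <-.
- by congr (P _); apply/seteqP; split => w /=; tauto.
- apply: measurableI; last exact: (mset mWr mC1).
  apply: measurableI; last exact: (mset mb2 mA2).
  by apply: measurableI => //; exact: (mset mb1 mA1).
- move=> B mB; have := step B mB; rewrite [in X in _ = X -> _]mulrAC => <-.
  by congr (P _); apply/seteqP; split => w /=; tauto.
Qed.

Transparent gauss2 channel_law.
(** Rectangles are extended to general sets in three uses of [joint_law]: the components of the
    symbol, those of the disturbance, and the pair formed by the two. *)
Let law3 (G : set ((R * R) * (R * R))) : measurable G ->
  P [set w | S w = M /\ G (b w ord0, (Wr w, Wi w))] = (p * fine (channel_law e s G))%:E.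
Proof.
have mbb : measurable_fun setT (fun w => b w ord0).
  rewrite (_ : (fun w => _) = (fun w => ((b w ord0).1, (b w ord0).2))).
    exact: measurable_fun_pair.
  by apply/funext => w; case: (b w ord0).
have mWW : measurable_fun setT (fun w => (Wr w, Wi w)) by exact: measurable_fun_pair.
have mset2 (h : T -> R * R) (A : set (R * R)) : measurable_fun setT h -> measurable A ->
    measurable [set w | A (h w)].
  by move=> mh mA; rewrite -[X in measurable X]setTI; exact: mh.
move=> mG; apply: (@joint_law _ _ _ P _ _ _ _ (gauss2 e) (gauss2 s)) => // B C mB mC.
have step C1 C2 : measurable C1 -> measurable C2 ->
  P [set w | ([set w | S w = M] `&` [set w | C1 (Wr w)] `&` [set w | C2 (Wi w)]) w /\
     B ((b w ord0).1, (b w ord0).2)] = (p * g s C1 * g s C2 * fine (gauss2 e B))%:E.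
  move=> mC1 mC2; apply: (@joint_law _ _ _ P _ _ _ _ (gauss e) (gauss e)) => //.
    apply: measurableI; last exact: (mset mWi mC2).
    by apply: measurableI => //; exact: (mset mWr mC1).
  move=> A1 A2 mA1 mA2; rewrite [RHS](_ : _ = (p * g e A1 * g e A2 * g s C1 * g s C2)%:E).
    by rewrite -law2//; congr (P _); apply/seteqP; split => w /=; tauto.
  by congr (_%:E); rewrite -/(g e A1) -/(g e A2); ring.
have := @joint_law _ _ _ P _ _ _ _ (gauss s) (gauss s)
  ([set w | S w = M] `&` [set w | B (b w ord0)]) Wr Wi (p * fine (gauss2 e B)) _ mWr mWi _ C mC.
rewrite mulrA => <-.
- by congr (P _); apply/seteqP; split => w /=; tauto.
- by apply: measurableI => //; exact: (mset2 _ _ mbb mB).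
move=> C1 C2 mC1 mC2; rewrite [RHS](_ : _ = (p * g s C1 * g s C2 * fine (gauss2 e B))%:E).
  rewrite -step//; congr (P _); apply/seteqP; split => w /=;
    rewrite -surjective_pairing; tauto.
by congr (_%:E); rewrite -/(g s C1) -/(g s C2); ring.
Qed.
Opaque gauss2 channel_law.

Let mf_outputE w : S w = M ->
  mf_output (S w) (b w) (z w) = chan_out (b w ord0, (Wr w, Wi w)).
Proof.
move=> Sw; rewrite /mf_output Sw /chan_out/=.
have E (x : 'I_K.+1 -> R) (y : 'I_N -> R) :
   \sum_(i < N) M i ord0 * (\sum_(k < K.+1) M i k * x k + y i) =
   x ord0 + (\sum_(k < K) corr (lift ord0 k) * x (lift ord0 k) + \sum_(i < N) M i ord0 * y i).
  under eq_bigr do rewrite mulrDr mulr_sumr.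
  rewrite big_split/= addrA; congr (_ + _); rewrite exchange_big/= big_ord_recl.
  congr (_ + _).
    rewrite -[RHS]mul1r -unit1 /corr mulr_suml.
    by apply: eq_bigr => i _; rewrite mulrA.
  apply: eq_bigr => k _; rewrite /corr mulr_suml.
  by apply: eq_bigr => i _; rewrite mulrA.
by rewrite (E (fun k => (b w k).1) (fun i => (z w i).1))
  (E (fun k => (b w k).2) (fun i => (z w i).2))
  /Wr /Wi !big_sumType/=.
Qed.

Lemma sum_coef_sd : \sum_i (coef i * sd i) ^+ 2 =
  e ^+ 2 * (\sum_(k < K) corr (lift ord0 k) ^+ 2) + v ^+ 2.
Proof.
rewrite big_sumType/=; congr (_ + _).
  by rewrite mulr_sumr; apply: eq_bigr => k _; rewrite exprMn mulrC.
(* The sequence of user 1 has norm 1, so filtering preserves the noise variance. *)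
rewrite -[RHS]mul1r -unit1 /corr mulr_suml.
by apply: eq_bigr => i _; rewrite exprMn expr2.
Qed.

Lemma mutual_info_matched_filter :
  mutual_info (cond_prob P [set w | S w = M]) (fun w => mf_output (S w) (b w) (z w))
    (fun w => b w ord0) =
  (log2 (1 + e ^+ 2 / (e ^+ 2 * (\sum_(k < K) corr (lift ord0 k) ^+ 2) + v ^+ 2)))%:E.
Proof.
have ss : 0 < e ^+ 2 * (\sum_(k < K) corr (lift ord0 k) ^+ 2) + v ^+ 2.
  by rewrite ltr_wpDl ?exprn_gt0// mulr_ge0 ?sqr_ge0// sumr_ge0// => k _; exact: sqr_ge0.
have s0 : 0 < s by rewrite sqrtr_gt0 sum_coef_sd.
have <- : s ^+ 2 = e ^+ 2 * (\sum_(k < K) corr (lift ord0 k) ^+ 2) + v ^+ 2.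
  by rewrite sqr_sqrtr sum_coef_sd// ltW.
rewrite -(mutual_info_channel e0 s0); apply: mutual_info_congr => A B mA mB.
have mG : measurable ((@chan_out R) @^-1` A `&` fst @^-1` B).
  apply: measurableI; rewrite -[X in measurable X]setTI.
    exact: measurable_chan_out.
  exact: measurable_fst.
rewrite /cond_prob.
have PS : P [set w | S w = M] = p%:E.
  have := law3 measurableT; rewrite probability_setT mulr1 => <-.
  by congr (P _); apply/seteqP; split => w //= [].
rewrite PS [X in P X](_ : _ =
  [set w | S w = M /\ ((@chan_out R) @^-1` A `&` fst @^-1` B) (b w ord0, (Wr w, Wi w))]).
  rewrite law3//= [p * _]mulrC mulfK ?gt_eqF// fineK//.
  exact: fin_num_measure.
apply/seteqP; split => w /=.
  by move=> [[HA HB] Sw]; rewrite -mf_outputE.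
by move=> [Sw [HA HB]]; rewrite mf_outputE.
Qed.

End conditional.

(** * Counting spreading sequences *)

Section codes.
Context {R : realType} (Ns n : nat).
Hypothesis Ns0 : (0 < Ns)%N.

(* position and sign (true for -) of the nonzero entry of each block *)
Definition code : finType := {ffun 'I_Ns -> 'I_n.+1 * bool}.

Lemma blk_subproof (i : 'I_(Ns * n.+1)) : (i %/ n.+1 < Ns)%N.
Proof. by rewrite ltn_divLR. Qed.
Definition blk (i : 'I_(Ns * n.+1)) : 'I_Ns := Ordinal (blk_subproof i).
Definition pos (i : 'I_(Ns * n.+1)) : 'I_n.+1 := Ordinal (ltn_pmod i (ltn0Sn n)).
Lemma idx_subproof (m : 'I_Ns) (r : 'I_n.+1) : (m * n.+1 + r < Ns * n.+1)%N.
Proof.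
by rewrite (@leq_trans (m.+1 * n.+1))// ?leq_mul2r ?ltn_ord ?orbT// mulSn addnC ltn_add2r.
Qed.
Definition idx (mr : 'I_Ns * 'I_n.+1) : 'I_(Ns * n.+1) := Ordinal (idx_subproof mr.1 mr.2).

Lemma blk_idx mr : blk (idx mr) = mr.1.
Proof. by apply/val_inj; rewrite /= divnMDl// divn_small ?addn0. Qed.
Lemma pos_idx mr : pos (idx mr) = mr.2.
Proof. by apply/val_inj; rewrite /= modnMDl modn_small. Qed.
Lemma idxK i : idx (blk i, pos i) = i.
Proof. by apply/val_inj; rewrite /= -divn_eq. Qed.

Lemma sum_idx (F : 'I_(Ns * n.+1) -> R) :
  \sum_i F i = \sum_m \sum_r F (idx (m, r)).
Proof.
rewrite pair_big/= (reindex idx).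
  by apply: eq_bigr => -[].
exists (fun i => (blk i, pos i)) => [mr _|i _]; last exact: idxK.
by rewrite blk_idx pos_idx; case: mr.
Qed.

Definition sgn (b : bool) : R := (-1) ^+ b.
Definition amp : R := (Num.sqrt Ns%:R)^-1.

Lemma amp_gt0 : 0 < amp. Proof. by rewrite invr_gt0 sqrtr_gt0 ltr0n. Qed.
Lemma amp2 : amp * amp = Ns%:R^-1.
Proof. by rewrite /amp -invfM -expr2 sqr_sqrtr// ler0n. Qed.

Definition code_vec (c : code) (i : 'I_(Ns * n.+1)) : R :=
  if pos i == (c (blk i)).1 then sgn (c (blk i)).2 * amp else 0.

Lemma sgn_amp_neq0 b : sgn b * amp != 0.
Proof. by rewrite mulf_neq0 ?signr_eq0// gt_eqF// amp_gt0. Qed.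

(** Injectivity lets sums over codes count each spreading sequence once. *)
Lemma code_vec_inj : injective code_vec.
Proof.
move=> c c' E; apply/ffunP => m.
have := congr1 (fun f => f (idx (m, (c m).1))) E.
rewrite /code_vec !pos_idx !blk_idx/= eqxx.
case: eqP => [e1|_ /eqP]; last by rewrite (negbTE (sgn_amp_neq0 _)).
have a0 : amp != 0 by rewrite gt_eqF// amp_gt0.
move=> /(mulIf a0); rewrite /sgn => /eqP; rewrite -subr_eq0 => e2.
move: e1 e2; case: (c m) => x b; case: (c' m) => x' b' /= -> e2.
congr (_, _); move: e2; case: b; case: b' => //=;
  by rewrite expr0 expr1 ?opprK -?opprD ?oppr_eq0 (_ : 1 + 1 = 2%:R) ?pnatr_eq0.
Qed.

(** A block with a single nonzero entry is determined by its position and its sign, so the valid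
    sequences are exactly the code vectors. *)
Lemma valid_seqP (v : 'I_(Ns * n.+1) -> R) :
  valid_seq v <-> exists c, v = code_vec c.
Proof.
split=> [[H1 H2]|[c ->]]; last first.
  split=> [m|i]; last first.
    rewrite /code_vec; case: ifP => _; last by rewrite eqxx.
    by move=> _; case: (_.2); rewrite /sgn ?expr0 ?expr1 ?mul1r ?mulN1r; [right|left].
  rewrite -(card1 (idx (m, (c m).1))); apply: eq_card => i.
  apply/idP/idP => [/set_mem/= /andP[/eqP im vi]|/eqP ->].
    have bm : blk i = m by apply/val_inj.
    move: vi; rewrite /code_vec bm; case: (pos i =P (c m).1) => [<- _|_]; last by rewrite eqxx.
    by rewrite inE -bm idxK.
  apply/mem_set => /=; rewrite /code_vec pos_idx blk_idx eqxx sgn_amp_neq0 andbT.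
  by have /(congr1 val)/= -> := blk_idx (m, (c m).1).
have H3 (m : 'I_Ns) : exists i : 'I_(Ns * n.+1),
    forall i' : 'I_(Ns * n.+1), ((i' %/ n.+1)%N == m) && (v i' != 0) = (i' == i).
  have [i Hi] := mem_card1 (H1 m); exists i => i'.
  have := Hi i'; rewrite [X in _ = X]inE => <-.
  by apply/idP/idP => [?|/set_mem//]; exact/mem_set.
have [f Hf] := choice H3.
have fb m : blk (f m) = m /\ v (f m) != 0.
  have /andP[/eqP E ->] : ((f m %/ n.+1)%N == m) && (v (f m) != 0) by rewrite Hf eqxx.
  split => //.
  exact/val_inj.
exists [ffun m => (pos (f m), v (f m) == - amp)].
apply/funext => i; rewrite /code_vec ffunE/=.
have [v0|v0] := eqVneq (v i) 0.
  rewrite v0; case: eqP => // E.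
  have fi : f (blk i) = i by rewrite -(idxK (f (blk i))) (fb _).1 -E idxK.
  by have := (fb (blk i)).2; rewrite fi v0 eqxx.
have fi : i = f (blk i).
  by apply/eqP; rewrite -Hf eqxx v0.
rewrite -fi eqxx; have a0 := amp_gt0.
have [->|->] := H2 i v0; rewrite -/amp.
  by rewrite -subr_eq0 opprK gt_eqF ?addr_gt0// /sgn expr0 mul1r.
by rewrite eqxx /sgn expr1 mulN1r.
Qed.

(** A block contributes only where the positions agree, and then [1 / Ns] times the product of the
    signs. *)
Lemma sum_code_vec (c c' : code) : \sum_i code_vec c i * code_vec c' i =
  Ns%:R^-1 * \sum_m (if (c m).1 == (c' m).1 then sgn (c m).2 * sgn (c' m).2 else 0).
Proof.
rewrite sum_idx mulr_sumr; apply: eq_bigr => m _.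
rewrite (bigD1 (c m).1)//= big1 ?addr0.
  rewrite /code_vec !pos_idx !blk_idx/= eqxx; case: ifP => _; last by rewrite !mulr0.
  by rewrite -amp2; ring.
by move=> r rm; rewrite /code_vec pos_idx blk_idx/= (negbTE rm) mul0r.
Qed.

Lemma code_vec_norm (c : code) : \sum_i code_vec c i * code_vec c i = 1.
Proof.
rewrite sum_code_vec (eq_bigr (fun=> 1)); last first.
  by move=> m _; rewrite eqxx /sgn -expr2 sqrr_sign.
by rewrite sumr_const card_ord mulVf// pnatr_eq0 -lt0n.
Qed.

Definition code_mx K (c : {ffun 'I_K -> code}) : 'M[R]_(Ns * n.+1, K) :=
  \matrix_(i, k) code_vec (c k) i.

Lemma code_mx_inj K : injective (@code_mx K).
Proof.
move=> c c' E; apply/ffunP => k; apply: code_vec_inj; apply/funext => i.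
by have /matrixP/(_ i k) := E; rewrite !mxE.
Qed.

Lemma spread_prob_code_mx K (c : {ffun 'I_K -> code}) :
  spread_prob (code_mx c) = (2 * n.+1)%:R ^- Ns ^+ K.
Proof.
rewrite /spread_prob (eq_bigr (fun=> (2 * n.+1)%:R ^- Ns)) ?prodr_const ?card_ord//.
move=> k _; rewrite /seq_prob (_ : (fun i => _) = code_vec (c k)); last first.
  by apply/funext => i; rewrite mxE.
by case: asboolP => // -[]; apply/valid_seqP; exists (c k).
Qed.

Lemma spread_prob_gt0P K (M : 'M[R]_(Ns * n.+1, K)) :
  0 < spread_prob M <-> exists c, M = code_mx c.
Proof.
split=> [M0|[c ->]]; last first.
  by rewrite spread_prob_code_mx exprn_gt0// invr_gt0 exprn_gt0// ltr0n.
have H k : exists c, (fun i => M i k) = code_vec c.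
  apply/valid_seqP; apply: contrapT => nv; move: M0.
  by rewrite /spread_prob (bigD1 k)//= /seq_prob; case: asboolP => // _; rewrite mul0r ltxx.
have [f Hf] := choice H.
exists [ffun k => f k]; apply/matrixP => i k; rewrite mxE ffunE.
by have := congr1 (fun g => g i) (Hf k).
Qed.

End codes.

Section code_sums.
Context {R : realType}.

(** The matrices of positive probability are the injective image of a finite type, and all have the
    same weight. *)
Lemma esum_code_mx Ns n K (w : 'M[R]_(Ns * n.+1, K) -> \bar R) (G : 'M[R]_(Ns * n.+1, K) -> R) :
  (0 < Ns)%N ->
  (forall M, w M = (spread_prob M)%:E) -> (forall M, 0 <= G M) ->
  (\esum_(M in [set M | (0 < w M)%E]) (w M * (G M)%:E))%E =
  ((2 * n.+1)%:R ^- Ns ^+ K * \sum_(c : {ffun 'I_K -> code Ns n}) G (code_mx c))%:E.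
Proof.
move=> Ns0 wE G0.
have w0 M : (0 <= w M)%E.
  rewrite wE lee_fin /spread_prob prodr_ge0// => k _; rewrite /seq_prob.
  by case: asboolP => // _; rewrite invr_ge0 exprn_ge0.
have GE c : (w (code_mx c) * (G (code_mx c))%:E)%E =
    ((2 * n.+1)%:R ^- Ns ^+ K * G (code_mx c))%:E.
  by rewrite wE spread_prob_code_mx.
rewrite (_ : [set M | _] = (@code_mx R Ns n K) @` setT).
  rewrite esum_image//; last by move=> c c' _ _; exact: code_mx_inj.
  rewrite (_ : setT = [set` index_enum {ffun 'I_K -> code Ns n}]); last first.
    by apply/seteqP; split => c //= _; rewrite mem_index_enum.
  rewrite esum_fset//; last by move=> c _; rewrite mule_ge0// lee_fin.
  rewrite -fsbig_seq ?index_enum_uniq// mulr_sumr -sumEFin; apply: eq_bigr => c _; exact: GE.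
apply/seteqP; split => M /=; rewrite wE lte_fin.
  by move/(spread_prob_gt0P Ns0) => [c ->]; exists c.
by move=> [c _ <-]; apply/(spread_prob_gt0P Ns0); exists c.
Qed.

End code_sums.

(** * Collisions of one interferer with user 1 *)

Section user.
Context {R : realType} (Ns n : nat).
Hypothesis Ns0 : (0 < Ns)%N.
Local Notation C := (code Ns n).

Definition rho2 (c c' : C) : R := (\sum_i code_vec c i * code_vec c' i) ^+ 2.

(* [hit]: the nonzero entries of the two sequences in block m collide *)
Let hit (c c' : C) m := (c m).1 == (c' m).1.
Let nohit c c' := [forall m, ~~ hit c c' m].
Let onehit c c' m := [forall m', hit c c' m' == (m' == m)].

Lemma rho2_ge0 c c' : 0 <= rho2 c c'. Proof. exact: sqr_ge0. Qed.

Lemma rho2_nohit c c' : nohit c c' -> rho2 c c' = 0.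
Proof.
move=> /forallP H; rewrite /rho2 sum_code_vec// big1 ?mulr0 ?expr0n// => m _.
by have := H m; rewrite /hit => /negbTE ->.
Qed.

(** The correlation is [1 / Ns] up to sign, and squaring removes the sign. *)
Lemma rho2_onehit c c' m : onehit c c' m -> rho2 c c' = ((Ns ^ 2)%:R)^-1.
Proof.
move=> /forallP H; rewrite /rho2 sum_code_vec// (bigD1 m)//= big1 ?addr0.
  have := H m; rewrite eqxx /hit => /eqP ->.
  rewrite natrX exprMn exprVn exprMn /sgn -!exprM ![(_ * 2)%N]mulnC !exprM.
  by rewrite !sqrrN expr1n !expr1n !mulr1.
by move=> m' mm'; have := H m'; rewrite (negbTE mm') /hit => /eqP ->.
Qed.

Lemma natr_forall (I : finType) (a : pred I) :
  ([forall i, a i])%:R = \prod_i (a i)%:R :> R.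
Proof.
case: forallP => [H|/forallP]; first by rewrite big1// => i _; rewrite H.
by rewrite negb_forall => /existsP[i ai]; rewrite (bigD1 i)//= (negbTE ai) mul0r.
Qed.

(** A block has [n.+1] positions; this is the probability that a uniform one avoids a given one. *)
Definition miss_rate : R := n%:R / n.+1%:R.
Definition nohit_prob : R := miss_rate ^+ Ns.
Definition onehit_prob : R := Ns%:R * (n.+1%:R^-1 * miss_rate ^+ Ns.-1).
Definition code_wt : R := (2 * n.+1)%:R ^- Ns.

Lemma card_code : code_wt * #|C|%:R = 1.
Proof.
rewrite card_ffun !card_prod !card_ord card_bool /code_wt mulnC natrX mulVf//.
Qed.

(** Independence of the blocks: by distributivity the mean of a product over blocks is the product
    of the block means. *)
Let wt_prod (F : 'I_Ns -> 'I_n.+1 * bool -> R) :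
  code_wt * \sum_(c : C) \prod_m F m (c m) = \prod_m ((2 * n.+1)%:R^-1 * \sum_x F m x).
Proof.
rewrite big_split/= prodr_const card_ord bigA_distr_bigA /code_wt exprVn.
by congr (_ * _); apply: eq_bigl => f; rewrite inE.
Qed.

Let sum_hit (r : 'I_n.+1) : (2 * n.+1)%:R^-1 * \sum_(x : 'I_n.+1 * bool) (r == x.1)%:R = n.+1%:R^-1 :> R.
Proof.
rewrite -(pair_big xpredT xpredT (fun (x : 'I_n.+1) (b : bool) => (r == x)%:R : R))/=.
under eq_bigr do rewrite sumr_const card_bool.
rewrite (bigD1 r)//= eqxx big1 ?addr0; last by move=> i ir; rewrite eq_sym (negbTE ir) mul0rn.
by rewrite (_ : true%:R *+ 2 = 2 :> R)// natrM; field; rewrite nat1r pnatr_eq0.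
Qed.

Let sum_miss (r : 'I_n.+1) : (2 * n.+1)%:R^-1 * \sum_(x : 'I_n.+1 * bool) (r != x.1)%:R = miss_rate :> R.
Proof.
have E (x : 'I_n.+1 * bool) : (r != x.1)%:R = 1 - (r == x.1)%:R :> R.
  by case: eqP => _; rewrite ?subrr ?subr0.
under eq_bigr do rewrite E.
rewrite sumrB mulrBr sum_hit sumr_const card_prod card_ord card_bool mulnC mulVf ?pnatr_eq0//.
by rewrite /miss_rate; field; rewrite nat1r pnatr_eq0.
Qed.

Lemma prob_nohit c : code_wt * \sum_(c' : C) (nohit c c')%:R = nohit_prob.
Proof.
under eq_bigr do rewrite natr_forall.
rewrite (wt_prod (fun m x => ((c m).1 != x.1)%:R)).
by under eq_bigr do rewrite sum_miss; rewrite prodr_const card_ord.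
Qed.

Lemma prob_onehit c : code_wt * \sum_(c' : C) \sum_m (onehit c c' m)%:R = onehit_prob.
Proof.
rewrite exchange_big/= mulr_sumr (eq_bigr (fun=> n.+1%:R^-1 * miss_rate ^+ Ns.-1)).
  by rewrite sumr_const card_ord /onehit_prob mulr_natl.
move=> m _; under eq_bigr do rewrite natr_forall.
rewrite (wt_prod (fun m' x => (((c m').1 == x.1) == (m' == m))%:R)).
rewrite (bigD1 m)//= eqxx; congr (_ * _).
  by rewrite -(sum_hit (c m).1); congr (_ * _); apply: eq_bigr => x _; rewrite eqb_id.
rewrite (eq_bigr (fun=> miss_rate)) ?prodr_const.
  by rewrite (eq_card (B := predC1 m))// cardC1 card_ord.
move=> m' mm'; rewrite -(sum_miss (c m').1); congr (_ * _).
by apply: eq_bigr => x _; rewrite (negbTE mm') eqbF_neg.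
Qed.

Let sum_le1 c c' : (nohit c c')%:R + \sum_m (onehit c c' m)%:R <= 1 :> R.
Proof.
have [m om|H] := pickP (onehit c c'); last first.
  by rewrite big1 ?addr0 ?lern1 ?leq_b1// => m _; rewrite H.
rewrite (bigD1 m)//= om big1 ?addr0.
  rewrite (_ : nohit c c' = false) ?add0r//; apply/negbTE/negP => /forallP/(_ m).
  by move/forallP: om => /(_ m); rewrite eqxx => /eqP ->.
move=> m' mm'; apply/eqP; rewrite pnatr_eq0 eqb0; apply/negP => /forallP/(_ m').
move/forallP: om => /(_ m'); rewrite (negbTE mm') eqxx => /eqP ->.
by [].
Qed.

(** Where neither case occurs, [Phi] is bounded by [B]; the factor after [B] is the probability of
    that remainder. *)
Lemma user_approx c (Phi : R -> R) (B : R) : 0 <= B -> (forall x, 0 <= x -> `|Phi x| <= B) ->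
  `|code_wt * (\sum_c' Phi (rho2 c c')) - (nohit_prob * Phi 0 + onehit_prob * Phi ((Ns ^ 2)%:R^-1))| <=
  B * (1 - (nohit_prob + onehit_prob)).
Proof.
move=> B0 PB.
have wt0 : 0 <= code_wt by rewrite invr_ge0 exprn_ge0.
have -> : B * (1 - (nohit_prob + onehit_prob)) =
    code_wt * \sum_(c' : C) (1 - ((nohit c c')%:R + \sum_m (onehit c c' m)%:R)) * B.
  rewrite -mulr_suml sumrB big_split/= [RHS]mulrA [in RHS]mulrBr [in RHS]mulrDr (prob_nohit c) (prob_onehit c).
  by rewrite sumr_const card_code mulrC.
have -> : code_wt * \sum_c' Phi (rho2 c c') - (nohit_prob * Phi 0 + onehit_prob * Phi (Ns ^ 2)%:R^-1) =
    code_wt * \sum_(c' : C) (Phi (rho2 c c') - ((nohit c c')%:R * Phi 0 +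
      (\sum_m (onehit c c' m)%:R) * Phi (Ns ^ 2)%:R^-1)).
  rewrite sumrB big_split/= mulrBr mulrDr -!mulr_suml !mulrA.
  by rewrite (prob_nohit c) (prob_onehit c).
rewrite normrM (ger0_norm wt0) ler_wpM2l//.
apply: (le_trans (ler_norm_sum _ _ _)); apply: ler_sum => c' _.
(* [Phi] is split along the complement and the cases of no or one collision; on the latter it
   already has the values [Phi 0] and [Phi (1 / Ns^2)]. *)
rewrite -[X in X - _](_ : (1 - ((nohit c c')%:R + \sum_m (onehit c c' m)%:R)) * Phi (rho2 c c') +
   ((nohit c c')%:R * Phi 0 + (\sum_m (onehit c c' m)%:R) * Phi ((Ns ^ 2)%:R^-1)) = _).
  rewrite addrK normrM ger0_norm ?subr_ge0// ler_wpM2l ?subr_ge0//.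
  by apply: PB; exact: rho2_ge0.
rewrite mulrBl mul1r mulrDl 
  -[RHS](subrK ((nohit c c')%:R * Phi 0 + (\sum_m (onehit c c' m)%:R) * Phi ((Ns ^ 2)%:R^-1))).
congr (_ - _ + _); congr (_ + _).
  by have [/rho2_nohit ->|] := boolP (nohit c c'); rewrite ?mul0r.
rewrite !mulr_suml; apply: eq_bigr => m _.
by have [/rho2_onehit ->|] := boolP (onehit c c' m); rewrite ?mul0r.
Qed.

Lemma hit_probs_ge0 : 0 <= nohit_prob /\ 0 <= onehit_prob.
Proof.
have q0 : 0 <= miss_rate by rewrite /miss_rate divr_ge0.
by rewrite /nohit_prob /onehit_prob !mulr_ge0 ?exprn_ge0 ?invr_ge0.
Qed.

End user.

(** * Replacing the interferers one at a time *)

Section users.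
Context {R : realType} (Ns n : nat).
Hypothesis Ns0 : (0 < Ns)%N.
Local Notation C := (code Ns n).
Local Notation nohit_prob := (@nohit_prob R Ns n).
Local Notation onehit_prob := (@onehit_prob R Ns n).
Local Notation code_wt := (@code_wt R Ns n).
Local Notation u := ((Ns ^ 2)%:R^-1 : R).

Lemma sum_ffun_recl (A : finType) K (F : A -> {ffun 'I_K -> A} -> R) :
  \sum_(c : {ffun 'I_K.+1 -> A}) F (c ord0) [ffun k => c (lift ord0 k)] =
  \sum_a \sum_c F a c.
Proof.
rewrite pair_big/=.
rewrite (reindex (fun ac : A * {ffun 'I_K -> A} =>
  [ffun k => if unlift ord0 k is Some j then ac.2 j else ac.1])).
  apply: eq_bigr => -[a c] _ /=; rewrite ffunE unlift_none; congr F.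
  by apply/ffunP => k; rewrite !ffunE liftK.
exists (fun c : {ffun 'I_K.+1 -> A} => (c ord0, [ffun k => c (lift ord0 k)])) => [[a c] _|c _].
  rewrite ffunE unlift_none; congr (_, _).
  by apply/ffunP => k; rewrite !ffunE liftK.
by apply/ffunP => k; rewrite ffunE; have [j ->|->] := unliftP ord0 k; rewrite ?ffunE.
Qed.

(** The mean over [K] interferers for a fixed sequence of user 1; the shift [x] holds the squared
    correlations of users already treated, as the induction requires. *)
Definition mean_users (g : R -> R) (c0 : C) K (x : R) : R :=
  code_wt ^+ K * \sum_(c : {ffun 'I_K -> C}) g (x + \sum_k rho2 c0 (c k)).

(* the weights have total mass (nohit_prob + onehit_prob) ^+ K < 1 *)
Definition mean_binomial (g : R -> R) K (x : R) : R :=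
  \sum_(j < K.+1) 'C(K, j)%:R * onehit_prob ^+ j * nohit_prob ^+ (K - j) * g (x + j%:R * u).

Lemma mean_usersS g c0 K x :
  mean_users g c0 K.+1 x = code_wt * \sum_c1 mean_users g c0 K (x + rho2 c0 c1).
Proof.
rewrite /mean_users -mulr_sumr exprS -mulrA; congr (_ * (_ * _)).
rewrite -(sum_ffun_recl (fun c1 (c : {ffun 'I_K -> C}) => g (x + rho2 c0 c1 + \sum_k rho2 c0 (c k)))).
apply: eq_bigr => c _; rewrite big_ord_recl addrA; congr (g (_ + _)).
by apply: eq_bigr => k _; rewrite ffunE.
Qed.

(** Pascal's rule: the additional user has no collision, or one, which shifts the argument by
    [u]. *)
Lemma mean_binomialS g K x :
  mean_binomial g K.+1 x = nohit_prob * mean_binomial g K x + onehit_prob * mean_binomial g K (x + u).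
Proof.
rewrite /mean_binomial big_ord_recl/= bin0 expr0 mulr1 subn0 mul0r addr0.
rewrite [X in nohit_prob * X]big_ord_recl/= bin0 expr0 mulr1 subn0 mul0r addr0.
under eq_bigr do rewrite /bump/= add1n binS natrD subSS !mulrDl.
rewrite big_split/= mulrDr addrA; congr (_ + _).
  rewrite exprS !mul1r !mulrA; congr (_ + _).
  rewrite big_ord_recr/= bin_small// !mul0r addr0 mulr_sumr.
  apply: eq_bigr => i _; rewrite /bump/= !add1n -(subnSK (ltn_ord i)) [nohit_prob ^+ _.+1]exprS; ring.
rewrite mulr_sumr; apply: eq_bigr => i _; rewrite exprS -natr1.
rewrite (_ : x + (i%:R + 1) * u = x + u + i%:R * u); first by ring.
by ring.
Qed.

Lemma mean_users_bound g c0 K x B : (forall y, 0 <= y -> `|g y| <= B) -> 0 <= x ->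
  `|mean_users g c0 K x| <= B.
Proof.
move=> gB x0; elim: K x x0 => [|K IH] x x0.
  rewrite /mean_users expr0 mul1r.
  rewrite (eq_bigr (fun=> g x)); last by move=> c _; rewrite big_ord0 addr0.
  by rewrite sumr_const card_ffun card_ord expn0 mulr1n gB.
rewrite mean_usersS normrM ger0_norm ?invr_ge0 ?exprn_ge0//.
apply: (@le_trans _ _ (code_wt * \sum_(c : C) B)).
  rewrite ler_wpM2l ?invr_ge0 ?exprn_ge0// (le_trans (ler_norm_sum _ _ _))// ler_sum// => c _.
  by rewrite IH// addr_ge0// rho2_ge0.
by rewrite sumr_const -[B *+ _]mulr_natl mulrA card_code mul1r.
Qed.

(** With [q = nohit_prob + onehit_prob], one replacement costs [B (1 - q)] and the earlier error is
    multiplied by [q]; the recursion [(1 - q) + q (1 - q^K) = 1 - q^(K+1)] closes exactly. *)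
Lemma mean_users_binomial g c0 K x B : (forall y, 0 <= y -> `|g y| <= B) -> 0 <= x ->
  `|mean_users g c0 K x - mean_binomial g K x| <= B * (1 - (nohit_prob + onehit_prob) ^+ K).
Proof.
move=> gB x0.
have B0 : 0 <= B by apply: le_trans (gB 0 (lexx _)).
have [p00 p10] := @hit_probs_ge0 R Ns n.
have u0 : 0 <= u by rewrite invr_ge0.
elim: K x x0 => [|K IH] x x0.
  rewrite /mean_users /mean_binomial expr0 mul1r subrr mulr0.
  rewrite (eq_bigr (fun=> g x)); last by move=> c _; rewrite big_ord0 addr0.
  rewrite sumr_const card_ffun card_ord expn0 mulr1n.
  by rewrite big_ord_recl big_ord0 addr0 bin0 !expr0 !mulr1 mul0r addr0 mul1r subrr normr0.
rewrite mean_usersS mean_binomialS.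
have := @user_approx R Ns n c0 (fun y => mean_users g c0 K (x + y)) B B0
  (fun y y0 => mean_users_bound c0 K gB (addr_ge0 x0 y0)).
rewrite addr0 => H1.
set F0 := mean_users g c0 K x in H1; set F1 := mean_users g c0 K (x + u) in H1.
set W := code_wt * _ in H1 *.
have H2 := IH x x0; have H3 := IH (x + u) (addr_ge0 x0 u0).
rewrite -/F0 in H2; rewrite -/F1 in H3.
set G0 := mean_binomial g K x in H2 *; set G1 := mean_binomial g K (x + u) in H3 *.
rewrite (_ : W - _ = (W - (nohit_prob * F0 + onehit_prob * F1)) +
  (nohit_prob * (F0 - G0) + onehit_prob * (F1 - G1))); last by ring.
apply: (le_trans (ler_normD _ _)); apply: (le_trans (lerD H1 (ler_normD _ _))).
rewrite [`|nohit_prob * _|]normrM [`|onehit_prob * _|]normrM (ger0_norm p00) (ger0_norm p10).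
apply: (le_trans (lerD (lexx _) (lerD (ler_wpM2l p00 H2) (ler_wpM2l p10 H3)))).
by rewrite exprS le_eqVlt; apply/orP; left; apply/eqP; ring.
Qed.

End users.

(** * Poisson limit *)

Section limits.
Context {R : realType}.

(** After taking logarithms, [ln (1 + x)] is squeezed between [x / (1 + x)] and [x]. *)
Lemma cvg_exp1D (m : nat -> nat) (x : nat -> R) (L : R) :
  (forall n, 0 <= x n) -> x @ \oo --> 0 -> (fun n => (m n)%:R * x n) @ \oo --> L ->
  (fun n => (1 + x n) ^+ m n) @ \oo --> expR L.
Proof.
move=> x0 xcvg mxcvg.
have x1 n : 0 < 1 + x n by rewrite ltr_pwDl.
have -> : (fun n => (1 + x n) ^+ m n) = (fun n => expR ((m n)%:R * ln (1 + x n))).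
  by apply/funext => n; rewrite expRM_natl lnK// posrE.
apply: (cvg_comp _ expR); last exact: continuous_expR.
apply: (@squeeze_cvgr _ _ _ _ (fun n => (m n)%:R * x n / (1 + x n)) (fun n => (m n)%:R * x n)) => //.
  apply: nearW => n; apply/andP; split.
    rewrite -mulrA ler_wpM2l//.
    (* The lower bound is the upper one applied to the reciprocal of [1 + x n]. *)
    have : ln (1 - x n / (1 + x n)) <= - (x n / (1 + x n)).
      apply: le_ln1Dx; rewrite ltrN2 ltr_pdivrMr// mul1r ltrDr//.
    rewrite (_ : 1 - x n / (1 + x n) = (1 + x n)^-1); last by field; rewrite gt_eqF.
    by rewrite lnV ?posrE// lerN2.
  rewrite ler_wpM2l// le_ln1Dx//.
  by rewrite (lt_le_trans _ (x0 n)).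
rewrite -[X in _ --> X]divr1; apply: cvgM => //.
apply: cvgV; first by rewrite oner_eq0.
rewrite -[X in _ --> X]addr0; apply: cvgD => //; exact: cvg_cst.
Qed.

(* Scheffe's argument: convergence of the total mass controls the tails, so no
   dominating sequence is needed *)
Lemma cvg_weighted_sum (a : nat -> nat -> R) (al h : nat -> R) (M : nat -> nat) (B : R) :
  (forall n j, 0 <= a n j) -> (forall n j, (M n <= j)%N -> a n j = 0) ->
  (forall j, (fun n => a n j) @ \oo --> al j) ->
  (fun n => \sum_(j < M n) a n j) @ \oo --> (1 : R) ->
  (fun m => \sum_(j < m) al j) @ \oo --> (1 : R) ->
  (forall j, `|h j| <= B) ->
  (fun n => \sum_(j < M n) a n j * h j) @ \oo -->
    limn (fun m => \sum_(j < m) al j * h j).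
Proof.
move=> a0 aM aal aS alS hB.
have B0 : 0 <= B by apply: le_trans (hB 0%N).
have al0 j : 0 <= al j.
  rewrite -(cvg_lim (@Rhausdorff R) (aal j)); apply: limr_ge; last exact: nearW.
  by apply/cvg_ex; exists (al j).
set s := (fun m => \sum_(j < m) al j * h j).
have cs : cvgn s.
  have -> : s = series (fun j => al j * h j).
    by apply/funext => m; rewrite /s /series/= big_mkord.
  apply: normed_cvg.
  apply: (@series_le_cvg _ _ (fun j => al j * B)) => [j|j|j|].
  - exact: normr_ge0.
  - exact: mulr_ge0.
  - by rewrite /= normrM ger0_norm// ler_wpM2l.
  have -> : series (fun j => al j * B) = (fun m => (\sum_(j < m) al j) * B).
    by apply/funext => m; rewrite /series/= big_mkord mulr_suml.
  by apply: is_cvgM; [apply/cvg_ex; exists 1|exact: is_cvg_cst].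
set L := limn s.
(* The error at cut-off [m] consists of the tail mass of [a n], the difference of the heads and the
   tail of the limit series. *)
have key n m : `|L - \sum_(j < M n) a n j * h j| <=
    B * (\sum_(j < M n) a n j - \sum_(j < m) a n j) +
    `|\sum_(j < m) a n j * h j - s m| + `|s m - L|.
  pose N := maxn (M n) m.
  have widen (F : nat -> R) : (forall j, (M n <= j)%N -> F j = 0) ->
      \sum_(j < M n) F j = \sum_(j < m) F j + \sum_(m <= j < N) F j.
    move=> F0; rewrite -!(big_mkord xpredT) -big_cat_nat ?leq_maxr//=.
    rewrite (@big_cat_nat _ _ _ (M n) 0 N)/= ?leq_maxl// [X in _ + X]big1_seq ?addr0// => j.
    by rewrite /= mem_index_iota => /andP[/F0 ->].
  rewrite (widen (a n)); last exact: aM.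
  rewrite (widen (fun j => a n j * h j)); last by move=> j /aM ->; rewrite mul0r.
  rewrite [X in B * X](_ : _ = \sum_(m <= j < N) a n j); last by rewrite addrAC subrr add0r.
  set A := \sum_(j < m) _; set X := \sum_(m <= j < N) _.
  have XB : `|X| <= B * \sum_(m <= j < N) a n j.
    rewrite mulr_sumr (le_trans (ler_norm_sum _ _ _))// ler_sum// => j _.
    by rewrite normrM ger0_norm// mulrC ler_wpM2r.
  rewrite (_ : L - (A + X) = - X + (- (A - s m) + - (s m - L))); last by ring.
  rewrite -addrA (le_trans (ler_normD _ _))// normrN lerD// (le_trans (ler_normD _ _))//.
  by rewrite !normrN.
apply/cvgrPdist_lt => e e0.
(* The cut-off [m] is fixed first, so that the limit in [n] of the bound is below [e]; then [n] is
   taken large. *)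
have lim_m : (fun m => B * (1 - \sum_(j < m) al j) + 0 + `|s m - L|) @ \oo --> (0 : R).
  rewrite -[X in _ --> X](_ : B * (1 - 1) + 0 + 0 = 0); last by rewrite subrr mulr0 !addr0.
  apply: cvgD.
    apply: cvgD; last exact: cvg_cst.
    by apply: cvgM; [exact: cvg_cst|apply: cvgB; [exact: cvg_cst|exact: alS]].
  have : (fun m => s m - L) @ \oo --> (0 : R).
    by rewrite -(subrr L); apply: cvgB; [exact: cs|exact: cvg_cst].
  by move/cvg_norm; rewrite normr0.
have [m _ Hm] := cvgr_lt 0 lim_m _ e0.
have {}Hm := Hm m (leqnn m).
have lim_n : (fun n => B * (\sum_(j < M n) a n j - \sum_(j < m) a n j) +
    `|\sum_(j < m) a n j * h j - s m| + `|s m - L|) @ \oo -->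
    B * (1 - \sum_(j < m) al j) + 0 + `|s m - L|.
  have sum_cvg k (F : nat -> nat -> R) (G : nat -> R) :
      (forall j, (fun n => F n j) @ \oo --> G j) ->
      (fun n => \sum_(j < k) F n j) @ \oo --> \sum_(j < k) G j.
    move=> FG; elim: k => [|k IH].
      rewrite big_ord0; under eq_fun do rewrite big_ord0; exact: cvg_cst.
    rewrite big_ord_recr/=; under eq_fun do rewrite big_ord_recr/=.
    by apply: cvgD => //; exact: FG.
  apply: cvgD; last exact: cvg_cst.
  apply: cvgD.
    by apply: cvgM; [exact: cvg_cst|apply: cvgB => //; exact: (sum_cvg m a al)].
  have : (fun n => \sum_(j < m) a n j * h j - s m) @ \oo --> (0 : R).
    rewrite -[X in _ --> X](subrr (s m)); apply: cvgB; last exact: cvg_cst.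
    apply: (sum_cvg m (fun n j => a n j * h j) (fun j => al j * h j)) => j.
    by apply: cvgM => //; exact: cvg_cst.
  by move/cvg_norm; rewrite normr0.
near=> n; apply: (le_lt_trans (key n m)); near: n.
exact: (cvgr_lt _ lim_n _ Hm).
Unshelve. all: by end_near. Qed.

Lemma cvg_poisson_sum (la : R) :
  (fun m => \sum_(j < m) (la ^+ j / (j`!)%:R * expR (- la))) @ \oo --> (1 : R).
Proof.
have -> : (fun m => \sum_(j < m) (la ^+ j / (j`!)%:R * expR (- la))) =
    (fun m => series (exp_coeff la) m * expR (- la)).
  by apply/funext => m; rewrite /series/= big_mkord mulr_suml.
rewrite -[X in _ --> X](_ : expR la * expR (- la) = 1); last first.
  by rewrite -expRD subrr expR0.
apply: cvgM; last exact: cvg_cst.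
exact: is_cvg_series_exp_coeff.
Qed.

(** Each of the [j] factors [(K - i) r] tends to [la], since [i r] tends to 0. *)
Lemma cvg_ffact (K : nat -> nat) (r : nat -> R) (la : R) j :
  (forall n, 0 <= r n) -> r @ \oo --> 0 -> (fun n => (K n)%:R * r n) @ \oo --> la ->
  (fun n => (K n ^_ j)%:R * r n ^+ j) @ \oo --> la ^+ j.
Proof.
move=> r0 rcvg Kr; elim: j => [|j IH].
  rewrite expr0 (_ : (fun n => _) = cst 1); first exact: cvg_cst.
  by apply/funext => n; rewrite ffactn0 expr0 mulr1.
have -> : (fun n => (K n ^_ j.+1)%:R * r n ^+ j.+1) =
   (fun n => ((K n ^_ j)%:R * r n ^+ j) * ((K n - j)%:R * r n)).
  by apply/funext => n; rewrite ffactnSr natrM exprSr mulrACA.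
rewrite exprSr; apply: cvgM => //.
(* The subtraction [K n - j] is truncated, which leaves the lower bound valid. *)
apply: (@squeeze_cvgr _ _ _ _ (fun n => (K n)%:R * r n - j%:R * r n) (fun n => (K n)%:R * r n)) => //.
  apply: nearW => n; apply/andP; split; last by rewrite ler_wpM2r// ler_nat leq_subr.
  by rewrite -mulrBl ler_wpM2r// lerBlDr -natrD ler_nat addnC -leq_subLR.
rewrite -[X in _ --> X](_ : la - j%:R * 0 = la); last by rewrite mulr0 subr0.
by apply: cvgB => //; apply: cvgM => //; exact: cvg_cst.
Qed.

End limits.

(** * Convergence of the collision counts *)

Section poisson.
Context {R : realType} (Ns : nat) (beta : R) (K : nat -> nat).
Hypothesis Ns0 : (0 < Ns)%N.
Hypothesis Kcvg : (fun n => (K n).+1%:R / (Ns * n.+1)%:R) @ \oo --> beta.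
Local Notation lambda := ((Ns ^ 2)%:R * beta).

(** The ratio of [onehit_prob] to [nohit_prob] at index [n.+1]. The shift avoids index 0, where a
    block has a single position and [nohit_prob] vanishes. *)
Let r n : R := Ns%:R * n.+1%:R^-1.

Let r_ge0 n : 0 <= r n. Proof. by rewrite mulr_ge0. Qed.
Let r_cvg : r @ \oo --> 0.
Proof.
rewrite -[X in _ --> X](mulr0 (Ns%:R : R)); apply: cvgM; first exact: cvg_cst.
exact: cvg_harmonic.
Qed.
Let Kr_cvg : (fun n => (K n.+1)%:R * r n) @ \oo --> lambda.
Proof.
(* The last factor converts [n.+2] into [n.+1], and the subtracted [r n] removes user 1 from the
   count of users. *)
have -> : (fun n => (K n.+1)%:R * r n) = (fun n =>
    ((K n.+1).+1%:R / (Ns * n.+2)%:R) * (Ns ^ 2)%:R * (1 + n.+1%:R^-1) - r n).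
  apply/funext => n; rewrite /r -!natr1 natrM natrX -!natr1; field.
  by rewrite !natr1 !pnatr_eq0/= -lt0n.
rewrite -[X in _ --> X](_ : beta * (Ns ^ 2)%:R * (1 + 0) - 0 = lambda); last first.
  by rewrite addr0 subr0 mulr1 mulrC.
apply: cvgB => //; apply: cvgM; last first.
  by apply: cvgD; [exact: cvg_cst|exact: cvg_harmonic].
apply: cvgM; last exact: cvg_cst.
by have := Kcvg; rewrite -(cvg_shiftS (fun n => (K n).+1%:R / (Ns * n.+1)%:R : R)).
Qed.

Let qE n : miss_rate n.+1 = (1 + n.+1%:R^-1)^-1 :> R.
Proof. by rewrite /miss_rate -[n.+2%:R]natr1; field; rewrite !(nat1r, natr1) !pnatr_eq0. Qed.

Let p0E n : nohit_prob Ns n.+1 ^+ K n.+1 = ((1 + n.+1%:R^-1) ^+ (Ns * K n.+1))^-1 :> R.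
Proof. by rewrite /nohit_prob qE -exprM exprVn. Qed.

Let p1E n : onehit_prob Ns n.+1 = nohit_prob Ns n.+1 * r n :> R.
Proof.
rewrite /onehit_prob /nohit_prob -[in RHS](prednK Ns0) exprS /r /miss_rate -[n.+2%:R]natr1; set Q := _ ^+ _.
by field; rewrite !(nat1r, natr1) !pnatr_eq0.
Qed.

Let p0K_cvg : (fun n => nohit_prob Ns n.+1 ^+ K n.+1) @ \oo --> expR (- lambda).
Proof.
under eq_fun do rewrite p0E; rewrite expRN.
apply: cvgV; first by rewrite gt_eqF// expR_gt0.
apply: cvg_exp1D => [n||]; first by rewrite invr_ge0.
  exact: cvg_harmonic.
rewrite (_ : (fun n => _) = (fun n => (K n.+1)%:R * r n)) //.
by apply/funext => n; rewrite /r natrM; ring.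
Qed.

Let a n j : R := 'C(K n.+1, j)%:R * onehit_prob Ns n.+1 ^+ j * nohit_prob Ns n.+1 ^+ (K n.+1 - j).

(** Taking out the full power [nohit_prob ^+ K] leaves powers of the ratio [r], to which [cvg_ffact]
    applies. *)
Let aE n j : a n j = nohit_prob Ns n.+1 ^+ K n.+1 * ((K n.+1 ^_ j)%:R * r n ^+ j) / (j`!)%:R.
Proof.
have j0 : (j`!)%:R != 0 :> R by rewrite pnatr_eq0 -lt0n fact_gt0.
rewrite /a -bin_ffact natrM.
have [jK|jK] := leqP j (K n.+1); last by rewrite bin_small// !mul0r mulr0 mul0r.
rewrite p1E exprMn 
  (_ : nohit_prob Ns n.+1 ^+ K n.+1 =
       nohit_prob Ns n.+1 ^+ j * nohit_prob Ns n.+1 ^+ (K n.+1 - j)).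
  by field; rewrite j0.
by rewrite -exprD subnKC.
Qed.

Let a_cvg j : (fun n => a n j) @ \oo --> lambda ^+ j / (j`!)%:R * expR (- lambda).
Proof.
rewrite (funext (aE^~ j)).
rewrite [X in _ --> X](_ : _ = expR (- lambda) * lambda ^+ j / (j`!)%:R); last by ring.
apply: cvgM; last exact: cvg_cst.
by apply: cvgM => //; exact: cvg_ffact.
Qed.

Let a_sum n : \sum_(j < (K n.+1).+1) a n j = (nohit_prob Ns n.+1 + onehit_prob Ns n.+1) ^+ K n.+1.
Proof.
rewrite exprDn; apply: eq_bigr => j _.
by rewrite /a -mulr_natl; ring.
Qed.

(** The mass is [nohit_prob ^+ K] times [(1 + r) ^+ K], with limits [exp (- lambda)] and
    [exp lambda]. Hence multiple collisions are asymptotically absent among all users together. *)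
Lemma mass_cvg : (fun n => (@nohit_prob R Ns n.+1 + onehit_prob Ns n.+1) ^+ K n.+1) @ \oo --> (1 : R).
Proof.
rewrite [X in _ --> X](_ : _ = expR (- lambda) * expR lambda); last first.
  by rewrite -expRD addNr expR0.
rewrite (_ : (fun n => _) = (fun n => nohit_prob Ns n.+1 ^+ K n.+1 * (1 + r n) ^+ K n.+1)); last first.
  by apply/funext => n; rewrite p1E -exprMn; congr (_ ^+ _); ring.
by apply: cvgM => //; exact: cvg_exp1D.
Qed.

Lemma mean_binomial_cvg (g : R -> R) (B : R) : (forall y, 0 <= y -> `|g y| <= B) ->
  (fun n => mean_binomial Ns n.+1 g (K n.+1) 0) @ \oo -->
  limn (fun m => \sum_(k < m) (lambda ^+ k / (k`!)%:R * expR (- lambda) *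
    g (k%:R / (Ns ^ 2)%:R))).
Proof.
move=> gB.
rewrite (_ : (fun n => _) = (fun n => \sum_(j < (K n.+1).+1) a n j * g (j%:R / (Ns ^ 2)%:R))).
  apply: (@cvg_weighted_sum R a (fun k => lambda ^+ k / (k`!)%:R * expR (- lambda))
    (fun k => g (k%:R / (Ns ^ 2)%:R)) (fun n => (K n.+1).+1) B).
  - move=> n j; have [c0 c1] := @hit_probs_ge0 R Ns n.+1.
    by rewrite /a !mulr_ge0// exprn_ge0.
  - by move=> n j jK; rewrite /a bin_small// !mul0r.
  - exact: a_cvg.
  - by under eq_fun do rewrite a_sum; exact: mass_cvg.
  - exact: cvg_poisson_sum.
  - by move=> j; apply: gB; rewrite divr_ge0.
by apply/funext => n; apply: eq_bigr => j _; rewrite add0r.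
Qed.

(** The binomial mean and the error bound do not depend on the sequence of user 1, so averaging over
    it preserves both. *)
Lemma users_cvg (g : R -> R) (B : R) : (forall y, 0 <= y -> `|g y| <= B) ->
  (fun n => code_wt Ns n ^+ (K n).+1 * \sum_(c : {ffun 'I_(K n).+1 -> code Ns n})
    g (\sum_k rho2 (c ord0) (c (lift ord0 k)))) @ \oo -->
  limn (fun m => \sum_(k < m) (lambda ^+ k / (k`!)%:R * expR (- lambda) *
    g (k%:R / (Ns ^ 2)%:R))).
Proof.
move=> gB; set L := limn _; set u := (X in X @ \oo --> _).
have B0 : 0 <= B by apply: le_trans (gB 0 (lexx _)).
rewrite -(cvg_shiftS u).
have uE n : u n = code_wt Ns n * \sum_(c0 : code Ns n) mean_users g c0 (K n) 0.
  rewrite [RHS](_ : _ = code_wt Ns n ^+ (K n).+1 * \sum_(c0 : code Ns n)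
    \sum_(c : {ffun 'I_(K n) -> code Ns n}) g (0 + \sum_k rho2 c0 (c k))); last first.
    rewrite [X in _ = X * _]exprS -[RHS]mulrA.
    by congr (_ * _); rewrite [RHS]mulr_sumr.
  congr (_ * _).
  rewrite -(sum_ffun_recl (fun c0 (c : {ffun 'I_(K n) -> code Ns n}) => g (0 + \sum_k rho2 c0 (c k)))).
  apply: eq_bigr => c _; rewrite add0r; congr g; apply: eq_bigr => k _.
  by rewrite ffunE.
have close n : `|mean_binomial Ns n g (K n) 0 - u n| <=
    B * (1 - (nohit_prob Ns n + onehit_prob Ns n) ^+ K n).
  have wt0 : 0 <= (code_wt Ns n : R) by rewrite invr_ge0 exprn_ge0.
  rewrite uE distrC.
  rewrite (_ : _ - _ = code_wt Ns n * \sum_(c0 : code Ns n)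
    (mean_users g c0 (K n) 0 - mean_binomial Ns n g (K n) 0)).
    rewrite normrM (ger0_norm wt0).
    apply: (@le_trans _ _ (code_wt Ns n * \sum_(c0 : code Ns n)
      (B * (1 - (nohit_prob Ns n + onehit_prob Ns n) ^+ K n)))).
      rewrite ler_wpM2l// (le_trans (ler_norm_sum _ _ _))// ler_sum// => c0 _.
      exact: mean_users_binomial.
    by rewrite sumr_const -[_ *+ #|_|]mulr_natl mulrA card_code mul1r.
  rewrite sumrB mulrBr sumr_const -[_ *+ #|_|]mulr_natl [X in _ = _ - X]mulrA card_code mul1r//.
have -> : (fun n => u n.+1) = (fun n => mean_binomial Ns n.+1 g (K n.+1) 0 -
    (mean_binomial Ns n.+1 g (K n.+1) 0 - u n.+1)).
  by apply/funext => n; rewrite subKr.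
rewrite -[L]subr0; apply: cvgB; first exact: mean_binomial_cvg gB.
apply/norm_cvg0P.
apply: (@squeeze_cvgr _ _ _ _ (cst 0)
  (fun n => B * (1 - (nohit_prob Ns n.+1 + onehit_prob Ns n.+1) ^+ K n.+1))).
- by apply: nearW => n; rewrite normr_ge0 close.
- exact: cvg_cst.
rewrite -[X in _ --> X](_ : B * (1 - 1) = 0); last by rewrite subrr mulr0.
apply: cvgM; first exact: cvg_cst.
by apply: cvgB; [exact: cvg_cst|exact: mass_cvg].
Qed.

End poisson.

(* Index n : nat corresponds to N_h = n.+1, N = Ns * n.+1; the number of
   users is K_N = (K n).+1 >= 1; user 1 is the index ord0.
   Complex numbers are pairs (real part, imaginary part) in R * R. *)
Theorem theorem3 (R : realType) (Ns : nat) (beta E N0 : R) (K : nat -> nat)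
  (d : measure_display) (Omega : nat -> measurableType d)
  (P : forall n, probability (Omega n) R)
  (S : forall n, Omega n -> 'M[R]_(Ns * n.+1, (K n).+1))
  (b : forall n, Omega n -> 'I_(K n).+1 -> (R * R)%type)
  (z : forall n, Omega n -> 'I_(Ns * n.+1) -> (R * R)%type) :
  (0 < Ns)%N -> 0 < beta -> 0 < E -> 0 < N0 ->
  (fun n => ((K n).+1)%:R / (Ns * n.+1)%:R) @ \oo --> beta ->
  (forall n (M : 'M[R]_(Ns * n.+1, (K n).+1)), measurable [set w | S n w = M]) ->
  (forall n i k, measurable_fun setT (fun w => S n w i k)) ->
  (forall n k, measurable_fun setT (fun w => (b n w k).1) /\
               measurable_fun setT (fun w => (b n w k).2)) ->
  (forall n i, measurable_fun setT (fun w => (z n w i).1) /\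
               measurable_fun setT (fun w => (z n w i).2)) ->
  (* joint law: S has independent (Ns, n.+1)-sequence columns; the real and
     imaginary parts of b_k (resp. n_i) are i.i.d. N(0, E/2) (resp.
     N(0, N0/2)), i.e. b_k ~ CN(0,E), n_i ~ CN(0,N0) i.i.d.; S, b, n are
     mutually independent *)
  (forall n (M : 'M[R]_(Ns * n.+1, (K n).+1))
     (Br Bi : 'I_(K n).+1 -> set R) (Zr Zi : 'I_(Ns * n.+1) -> set R),
     (forall k, measurable (Br k) /\ measurable (Bi k)) ->
     (forall i, measurable (Zr i) /\ measurable (Zi i)) ->
     P n [set w | S n w = M /\
                  (forall k, Br k (b n w k).1 /\ Bi k (b n w k).2) /\
                  (forall i, Zr i (z n w i).1 /\ Zi i (z n w i).2)]
     = (spread_prob M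
        * (\prod_(k < (K n).+1)
             (fine (normal_prob 0 (Num.sqrt (E / 2)) (Br k))
              * fine (normal_prob 0 (Num.sqrt (E / 2)) (Bi k))))
        * (\prod_(i < Ns * n.+1)
             (fine (normal_prob 0 (Num.sqrt (N0 / 2)) (Zr i))
              * fine (normal_prob 0 (Num.sqrt (N0 / 2)) (Zi i)))))%:E) ->
  (fun n => (beta%:E *
     cond_mutual_info (P n)
       (fun w => mf_output (S n w) (b n w) (z n w))
       (fun w => b n w ord0)
       (S n))%E) @ \oo --> (ITH_sumf beta (E / N0) Ns)%:E.
Proof.
move=> Ns0 beta0 E0 N00 Kcvg mS _ mb mz law.
pose ga := E / N0.
have ga0 : 0 < ga by rewrite divr_gt0.
(* Nonnegativity of [g] serves the extended sum over matrices, its upper bound the limit. *)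
pose g (x : R) : R := log2 (1 + ga / (1 + x * ga)).
have ln2 : 0 < ln (2 : R) by rewrite ln_gt0 ?ltr1n.
have gB y : 0 <= y -> 0 <= g y <= log2 (1 + ga).
  move=> y0; have y1 : 0 < 1 + y * ga by rewrite ltr_pwDl// mulr_ge0// ltW.
  have gy : 0 <= ga / (1 + y * ga) by rewrite divr_ge0// ltW.
  apply/andP; split.
    by rewrite /g /log2 divr_ge0 ?(ltW ln2)// ln_ge0// lerDl.
  rewrite /g /log2 ler_pM2r ?invr_gt0// ler_ln ?posrE; [|by rewrite ltr_pwDl|by rewrite ltr_pwDl// ltW].
  by rewrite lerD2l ler_pdivrMr// ler_peMr ?(ltW ga0)// lerDl mulr_ge0// ltW.
pose u n := code_wt Ns n ^+ (K n).+1 * \sum_(c : {ffun 'I_(K n).+1 -> code Ns n})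
    g (\sum_k rho2 (c ord0) (c (lift ord0 k))).
have uE n : cond_mutual_info (P n)
       (fun w => mf_output (S n w) (b n w) (z n w))
       (fun w => b n w ord0) (S n) = (u n)%:E.
  have PS M : P n [set w | S n w = M] = (spread_prob M)%:E.
    have := law n M (fun=> setT) (fun=> setT) (fun=> setT) (fun=> setT)
      (fun=> conj measurableT measurableT) (fun=> conj measurableT measurableT).
    rewrite !big1 ?mulr1; last 2 first.
    - by move=> k _; rewrite probability_setT mulr1.
    - by move=> k _; rewrite probability_setT mulr1.
    by move=> <-; congr (P n _); apply/seteqP; split => w //= [].
  have e0 : 0 < Num.sqrt (E / 2) by rewrite sqrtr_gt0 divr_gt0.
  have v0 : 0 < Num.sqrt (N0 / 2) by rewrite sqrtr_gt0 divr_gt0.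
  pose G (M : 'M[R]_(Ns * n.+1, (K n).+1)) := g (\sum_(k < K n) corr M (lift ord0 k) ^+ 2).
  have G0 M : 0 <= G M.
    have s0 : 0 <= \sum_(k < K n) corr M (lift ord0 k) ^+ 2.
      by apply: sumr_ge0 => k _; exact: sqr_ge0.
    by have /andP[-> _] := gB _ s0.
  (* Only matrices of positive probability are conditioned on; they come from codes, so their first
     column has norm 1. *)
  transitivity (\esum_(M in [set M | (0 < P n [set w | S n w = M])%E])
      (P n [set w | S n w = M] * (G M)%:E))%E.
    apply: eq_esum => M /=; rewrite PS lte_fin => pM; congr (_ * _)%E.
    have [c Mc] := (spread_prob_gt0P Ns0 M).1 pM.
    have c1 : corr M ord0 = 1.
      rewrite /corr Mc -(code_vec_norm (R := R) Ns0 (c ord0)).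
      by apply: eq_bigr => i _; rewrite !mxE.
    have -> := mutual_info_matched_filter pM e0 v0 (mS n M) (mb n) (mz n) (law n M) c1.
    (* The factors 1/2 from splitting into real and imaginary parts cancel in the
       signal-to-interference ratio. *)
    congr (_%:E); rewrite /G /g; congr (log2 (1 + _)).
    have E2 : 0 <= E / 2 by rewrite divr_ge0 // ltW.
    have N2 : 0 <= N0 / 2 by rewrite divr_ge0 // ltW.
    rewrite (sqr_sqrtr E2) (sqr_sqrtr N2).
    set x := \sum_(k < _) _; have x0 : 0 <= x by apply: sumr_ge0 => k _; exact: sqr_ge0.
    rewrite /ga; field.
    by rewrite !gt_eqF//= ltr_pwDl// mulr_ge0// ltW.
  rewrite (esum_code_mx Ns0 PS G0) /u /code_wt; congr (_%:E).
  congr (_ * _); apply: eq_bigr => c _; rewrite /G; congr g.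
  apply: eq_bigr => k _; rewrite /corr /rho2; congr (_ ^+ 2).
  by apply: eq_bigr => i _; rewrite !mxE.
have gB' y : 0 <= y -> `|g y| <= log2 (1 + ga).
  by move=> /gB/andP[g0 g1]; rewrite ger0_norm.
have := users_cvg Ns0 Kcvg gB' => ucvg.
rewrite (_ : (fun n => _) = (fun n => (beta * u n)%:E)); last first.
  by apply/funext => n; rewrite uE -EFinM.
apply: cvg_EFin; first exact: nearW.
rewrite /ITH_sumf; apply: cvgM; first exact: cvg_cst.
exact: ucvg.
Qed.
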